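(* Let $s>0$ and $b>2s$. Let $k\geq2$ be the unique integer such that $ks<b\leq(k+1)s$, and let $\Lambda_1,\dots,\Lambda_k$ be pairwise disjoint embedded closed curves in $D(b)$ that each bound a domain of area $s$. If $\phi$ is a Hamiltonian diffeomorphism of $\mathbb{R}^2$ that maps $L(s)$ into $D(b)$, then $\phi(L(s))$ must intersect at least one of the $\Lambda_j$.
   Context: $\mathbb{R}^2=\mathbb{C}$ carries its standard area form. A Hamiltonian diffeomorphism is the time-one map of the flow of a smooth, possibly time-dependent, Hamiltonian function. $D(b)=\{\pi|z|^2<b\}$ is the standard open disk of area $b$ and $L(s)=\{\pi|z|^2=s\}$ is the standard circle enclosing area $s$. *)

(* Defs.v *)
From HB Require Import structures.
From mathcomp Require Import all_boot all_order all_algebra.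
From mathcomp Require Import all_classical all_reals all_analysis.

Set Implicit Arguments.
Unset Strict Implicit.
Unset Printing Implicit Defensive.
Import Order.TTheory GRing.Theory Num.Theory.
Import numFieldNormedType.Exports.

Local Open Scope classical_set_scope.
Local Open Scope ring_scope.

Section Smooth.
Context {R : realType} {V W : normedModType R}.

(* For finite-dimensional V this is the usual notion of a C^n map: all iterated
   directional derivatives of order at most n exist and are continuous. *)
Fixpoint class_C (n : nat) (f : V -> W) : Prop :=
  continuous f /\
  if n is m.+1 then
    forall v, (forall x, derivable f x v) /\ class_C m (fun x => 'D_v f x)
  else True.

Definition smooth (f : V -> W) : Prop := forall n, class_C n f.

End Smooth.

Definition diffeomorphism {R : realType} {V W : normedModType R} (f : V -> W) :
    Prop :=
  smooth f /\ exists g : W -> V, [/\ smooth g, cancel f g & cancel g f].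

Section Plane.
Context {R : realType}.

(* The plane R^2 = C is R * R; its norm in the library is the sup norm, so the
   Euclidean |z|^2 is written out. *)
Definition sqnorm (z : R * R) : R := z.1 ^+ 2 + z.2 ^+ 2.

Definition std_disk (b : R) : set (R * R) := [set z | pi * sqnorm z < b].

Definition std_circle (s : R) : set (R * R) := [set z | pi * sqnorm z = s].

Definition area (A : set (R * R)) : \bar R :=
  (lebesgue_measure \x lebesgue_measure)%E A.

(* The vector field X with omega(X, .) = dh for omega = dx /\ dy; the opposite
   sign convention amounts to replacing h by - h. *)
Definition hamiltonian_vector_field (h : R * R -> R) (z : R * R) : R * R :=
  ('D_((0, 1) : R * R) h z, - 'D_((1, 0) : R * R) h z).

(* Phi t is the time-t map, for t in [0, 1], of the flow of the time-dependent
   Hamiltonian H; nothing is asked of Phi t for other t. The two-sided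
   derivatives at t = 0 and t = 1 are no restriction: a trajectory on [0, 1]
   can be extended differentiably past the end points. *)
Definition hamiltonian_flow (H : R * (R * R) -> R) (Phi : R -> R * R -> R * R) :
    Prop :=
  forall z, Phi 0 z = z /\
    forall t : R, 0 <= t <= 1 ->
      is_derive t (1 : R) (fun u => Phi u z)
        (hamiltonian_vector_field (fun w => H (t, w)) (Phi t z)).

(* That the time-one map is defined on the whole plane does not make it onto,
   hence the first conjunct. *)
Definition hamiltonian_diffeomorphism (phi : R * R -> R * R) : Prop :=
  diffeomorphism phi /\
  exists (H : R * (R * R) -> R) (Phi : R -> R * R -> R * R),
    [/\ smooth H, hamiltonian_flow H Phi & phi = Phi 1].

(* The image of a continuous injective map (hence a topological embedding) of
   the circle [0, 1] / (0 ~ 1); no differentiability is required. *)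
Definition embedded_closed_curve (L : set (R * R)) : Prop :=
  exists gamma : R -> R * R,
    [/\ {within `[0, 1], continuous gamma},
        gamma 0 = gamma 1,
        {in `[0, 1[ &, injective gamma} &
        L = gamma @` `[0, 1]].

Definition bounds_domain_of_area (L : set (R * R)) (s : R) : Prop :=
  exists U : set (R * R),
    [/\ open U, connected U, bounded_set U,
        closure U `\` interior U = L & area U = s%:E].

End Plane.

(* Main.v *)
(* A curve bounding a domain of area s is the connected boundary of that domain,
   and so is phi(L(s)) for phi(D(s)), because a Hamiltonian diffeomorphism
   preserves area. Two domains with disjoint connected boundaries are disjoint
   or nested, or else their union would be bounded, open and closed; equal areas
   exclude nesting. If phi(L(s)) missed all Lambda_j, there would thus be k + 1
   disjoint domains of area s in D(b), with closures contained in D(b). Finitely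
   many such closures cannot fill the connected open disk, hence
   (k + 1) s < b, a contradiction.

   For area preservation, no differentiability of the flow in the initial point
   is assumed at intermediate times: the determinant of two finite differences
   along neighbouring trajectories is almost constant in time, by Gronwall's
   inequality and the vanishing of the divergence, and this determines the
   Jacobian of the time-one map. *)

Require Import Defs.
From HB Require Import structures.
From mathcomp Require Import all_boot all_order all_algebra.
From mathcomp Require Import all_classical all_reals all_analysis.
From mathcomp Require Import measurable_realfun.
From mathcomp Require Import zify ring lra.
Set Implicit Arguments.
Unset Strict Implicit.
Unset Printing Implicit Defensive.
Import Order.TTheory GRing.Theory Num.Theory.
Import numFieldNormedType.Exports.
Local Open Scope classical_set_scope.
Local Open Scope ring_scope.

(** * Regions with connected boundary in the plane *)

(** A Jacobian determinant equal to 1 is turned into equality of areas through two upper bounds. On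
    a small dyadic square the map is nearly affine with determinant 1, so the image lies in an
    affine image of a slightly larger square; this bounds its area from above without deciding which
    points are hit. Summing over squares gives that the area of phi(B) is at most that of B. The
    opposite inequality is the same bound for the inverse map, which is the time-one map of the flow
    run backwards. This is why the flow estimates are stated for divergence-free fields in general.
    Invariance of area under affine maps of determinant 1 comes from shears, which translate every
    line of one coordinate direction.

    The final inequality has to be strict because [b = k.+1%:R * s] is allowed; strictness comes
    from the nonempty open part of the disk that the closed domains leave free. *)

Lemma image_can2 (T U : Type) (f : T -> U) (g : U -> T) (A : set T) :
  cancel f g -> cancel g f -> f @` A = g @^-1` A.
Proof.
move=> fK gK; apply/seteqP; split=> z; first by move=> [w Aw <-]; rewrite /= fK.
by move=> Agz; exists (g z).
Qed.

(** [C]&[U] is open in [C], and closed in [C] because it equals [C]&[closure U]. *)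
Lemma connected_sub_open (T : topologicalType) (C U : set T) :
  connected C -> open U -> C `&` closure U `<=` U -> C `&` U !=set0 ->
  C `<=` U.
Proof.
move=> Cc oU CU CU0; suff <- : C `&` U = C by apply: subIsetr.
apply: Cc => //; first by exists U.
exists (closure U); first exact: closed_closure.
apply/seteqP; split=> x [Cx Ux]; split=> //; first exact: subset_closure.
exact: CU.
Qed.

(* The sets C and D play the role of the boundary curves. If each curve lies
   in the other region, then the union of the two regions is clopen. *)
Lemma disjoint_or_nested (T : topologicalType) (U V C D : set T) :
  open U -> connected U -> connected C -> U `&` C = set0 ->
  closure U `<=` U `|` C ->
  open V -> connected V -> connected D -> V `&` D = set0 ->
  closure V `<=` V `|` D ->
  C `&` D = set0 -> ~ (closure (U `|` V) `<=` U `|` V) ->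
  [\/ U `&` V = set0, closure V `<=` U | closure U `<=` V].
Proof.
move=> oU cU cC UC clU oV cV cD VD clV CD ncl.
(* If the boundary [E] of [A] misses [B] and [A] meets [B], then the connected set [B] cannot leave
   [A]. A point of [closure B] on [E] would lie in [B] or on [F], and [E] misses both. *)
have nested (A B E F : set T) : open A -> connected A -> open B -> connected B ->
    A `&` E = set0 -> B `&` F = set0 -> E `&` F = set0 ->
    closure A `<=` A `|` E -> closure B `<=` B `|` F -> E `&` B = set0 ->
    A `&` B = set0 \/ closure B `<=` A.
  move=> oA cA oB cB AE BF EF clA clB EB.
  have [->|/set0P AB] := eqVneq (A `&` B) set0; [by left|right].
  have BA : B `<=` A.
    apply: connected_sub_open => //; last by rewrite setIC.
    move=> x [Bx /clA[//|Ex]]; have : (E `&` B) x by [].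
    by rewrite EB.
  move=> x clBx; have [//|Ex] := clA _ (closureS BA clBx).
  by have [Bx|Fx] := clB _ clBx;
    [have : (E `&` B) x by []|have : (E `&` F) x by []]; rewrite ?EB ?EF.
have [CV|/set0P CV] := eqVneq (C `&` V) set0.
  have [] := nested U V C D oU cU oV cV UC VD CD clU clV CV.
    by move=> ?; apply: Or31.
  by move=> ?; apply: Or32.
have [DU|/set0P DU] := eqVneq (D `&` U) set0.
  have [] := nested V U D C oV cV oU cU VD UC _ clV clU DU.
  - by rewrite setIC.
  - by rewrite setIC => ?; apply: Or31.
  - by move=> ?; apply: Or33.
(* Here [C] meets [V] and avoids its boundary [D], so all of [C] lies in [V]; likewise all of [D]
   lies in [U]. *)
exfalso; apply: ncl; rewrite closureU => x [/clU|/clV] [] xH; [by left| |by right|].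
- right; apply: (connected_sub_open cC oV _ CV) => // y [Cy /clV[//|Dy]].
  have : (C `&` D) y by [].
  by rewrite CD.
- left; apply: (connected_sub_open cD oU _ DU) => // y [Dy /clU[//|Cy]].
  have : (C `&` D) y by [].
  by rewrite CD.
Qed.

Section PlaneTopology.
Context {R : realType}.
Implicit Types (U V C : set (R * R)) (z : R * R).

Lemma ray_connected z v :
  connected ((fun t : R => z + t *: v) @` `[0, +oo[).
Proof.
apply: connected_continuous_connected.
  by apply/connected_intervalP; exact: interval_is_interval.
apply: continuous_subspaceT => t.
by apply: cvgD; [exact: cvg_cst|apply: cvgZr_tmp; exact: cvg_id].
Qed.

Lemma ray_unbounded z v (A : set (R * R)) :
  v != 0 -> bounded_set A -> ~ ((fun t : R => z + t *: v) @` `[0, +oo[ `<=` A).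
Proof.
move=> v0 [M [Mr AM]] sub.
have n0 : 0 < `|v| by rewrite normr_gt0.
pose N := `|M| + 1.
have MN : M < N by rewrite (le_lt_trans (ler_norm M))// /N ltrDl.
(* With this [t] the vector [t *: v] has norm [N + |z| + 1], so [z + t *: v] has norm at least
   [N + 1]. *)
pose t := (N + `|z| + 1) / `|v|.
have t0 : 0 <= t by rewrite divr_ge0// /N !addr_ge0.
have /(AM N MN) : A (z + t *: v).
  by apply: sub; exists t => //=; rewrite in_itv/= t0.
move=> /= h; have := ler_normB (z + t *: v) z.
rewrite addrAC subrr add0r normrZ (ger0_norm t0) /t divfK ?gt_eqF//.
by move: h; set a := `|z + _|; lra.
Qed.

(** A ray from a point of a clopen set would stay in the set. *)
Lemma bounded_open_not_closed U :
  open U -> bounded_set U -> U !=set0 -> ~ (closure U `<=` U).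
Proof.
move=> oU bU [z Uz] clU.
apply: (@ray_unbounded z ((1, 0) : R * R) U _ bU).
  by apply/eqP => -[/eqP]; rewrite oner_eq0.
apply: connected_sub_open => //; first exact: ray_connected.
- by move=> x [_ /clU].
- by exists z; split=> //; exists 0; rewrite ?scale0r ?addr0//= in_itv/= lexx.
Qed.

(** From a point of [U] outside the disk, the radial ray pointing outwards stays outside the disk.
    It therefore never meets [C] and cannot leave the bounded set [U]. *)
Lemma region_sub_disk (b : R) U C :
  open U -> bounded_set U -> closure U `<=` U `|` C -> C `<=` std_disk b ->
  U `<=` std_disk b.
Proof.
move=> oU bU clU CD z Uz; apply: contrapT => nDz.
(* At the origin the radial ray degenerates. Instead, [U] has a boundary point, which lies in the
   disk; so [b] is positive and the disk contains the origin. *)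
have [z0|z0] := eqVneq z 0.
  have [w Uw] : exists w, closure U w /\ ~ U w.
    apply: contrapT => h; apply: (bounded_open_not_closed oU bU).
      by exists z.
    by move=> x clx; apply: contrapT => nx; apply: h; exists x.
  case: Uw => /clU[//|/CD Dw] _; apply: nDz.
  move: Dw; rewrite z0 /std_disk /sqnorm /= => h; apply: le_lt_trans h.
  rewrite expr0n /= addr0 mulr0 mulr_ge0 ?pi_ge0//.
  by rewrite addr_ge0// sqr_ge0.
apply: (@ray_unbounded z z U z0 bU).
apply: connected_sub_open => //; first exact: ray_connected.
  move=> x [[t /= +] <-] /clU[//|/CD].
  rewrite in_itv/= andbT => t0 Dz; exfalso; apply: nDz; apply: le_lt_trans Dz.
  rewrite ler_pM2l ?pi_gt0// /sqnorm /=.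
  have e (u : R) : u ^+ 2 <= (u + t * u) ^+ 2.
    have -> : (u + t * u) ^+ 2 = u ^+ 2 + (2 * t + t ^+ 2) * u ^+ 2 by ring.
    by rewrite lerDl mulr_ge0 ?sqr_ge0// addr_ge0 ?sqr_ge0// mulr_ge0.
  exact: lerD.
by exists z; split=> //; exists 0; rewrite ?scale0r ?addr0//= in_itv/= lexx.
Qed.

Lemma continuous_sqnorm : continuous (@sqnorm R).
Proof.
by move=> z; apply: cvgD; apply: cvgM; (exact: cvg_fst || exact: cvg_snd).
Qed.

Lemma open_std_disk (b : R) : open (@std_disk R b).
Proof.
have -> : std_disk b = (fun z => pi * sqnorm z) @^-1` [set x : R | x < b] by [].
apply: open_comp; last exact: open_lt.
by move=> z _; apply: cvgMl_tmp; exact: continuous_sqnorm.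
Qed.

Lemma closed_closed_disk (b : R) : closed [set z : R * R | pi * sqnorm z <= b].
Proof.
apply: (@closed_comp _ _ (fun z => pi * sqnorm z) [set x : R | x <= b]).
  by move=> z _; apply: cvgMl_tmp; exact: continuous_sqnorm.
exact: closed_le.
Qed.

Lemma std_disk_scale (b t : R) z : 0 <= t <= 1 -> std_disk b z ->
  std_disk b (t *: z).
Proof.
move=> /andP[t0 t1] Dz; apply: le_lt_trans Dz.
rewrite ler_pM2l ?pi_gt0// /sqnorm /= !exprMn -mulrDr ler_piMl//.
  by rewrite addr_ge0// sqr_ge0.
by rewrite expr_le1.
Qed.

Lemma std_disk_connected (b : R) : connected (@std_disk R b).
Proof.
have -> : @std_disk R b = \bigcup_(z in std_disk b) ((fun t : R => t *: z) @` `[0, 1]).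
  apply/seteqP; split=> z.
    move=> Dz; exists z => //; exists 1; rewrite ?scale1r//= in_itv/= lexx.
    by rewrite ler01.
  by move=> [w Dw [t /=]]; rewrite in_itv/= => t01 <-; exact: std_disk_scale.
apply: bigcup_connected.
  exists 0 => z _; exists 0; rewrite ?scale0r//= in_itv/= lexx.
  by rewrite ler01.
move=> z _; apply: connected_continuous_connected; first exact: segment_connected.
by apply: continuous_subspaceT => t; apply: cvgZr_tmp; exact: cvg_id.
Qed.

Lemma compact_closed_disk (b : R) :
  compact [set z : R * R | pi * sqnorm z <= b].
Proof.
(* [x ^+ 2 <= c] implies [|x| <= c + 1], which gives a bounding square without a square root. *)
pose r := b / pi + 1.
apply: (@subclosed_compact _ _ (`[- r, r] `*` `[- r, r])).
- exact: closed_closed_disk.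
- by apply: compact_setX; exact: segment_compact.
- move=> [x y]; rewrite /sqnorm /= mulrC -ler_pdivlMr ?pi_gt0// => h.
  have [hx hy] : x ^+ 2 <= b / pi /\ y ^+ 2 <= b / pi.
    by split; apply: le_trans h; rewrite ?lerDl ?lerDr sqr_ge0.
  by split; rewrite /= in_itv/= /r; apply/andP; split; nra.
Qed.

Lemma bounded_std_disk (b : R) : bounded_set (@std_disk R b).
Proof.
have [M [Mr h]] := compact_bounded (@compact_closed_disk b).
by exists M; split=> // x Mx z Dz; apply: (h x Mx); exact: ltW.
Qed.

Lemma std_circle_connected (s : R) : 0 < s -> connected (@std_circle R s).
Proof.
move=> s0; pose r := Num.sqrt (s / pi).
have sp0 : 0 < s / pi by rewrite divr_gt0// pi_gt0.
have r2 : r ^+ 2 = s / pi by rewrite sqr_sqrtr// ltW.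
have r0 : 0 < r by rewrite sqrtr_gt0.
have -> : std_circle s = (fun t : R => (r * cos t, r * sin t)) @` setT.
  apply/seteqP; split=> z.
    rewrite /std_circle /sqnorm /= => e.
    have e2 : z.1 ^+ 2 + z.2 ^+ 2 = r ^+ 2.
      by rewrite r2 -e mulrC mulKf// gt_eqF// pi_gt0.
    pose x := z.1 / r; pose y := z.2 / r.
    have xy : x ^+ 2 + y ^+ 2 = 1.
      by rewrite /x /y !expr_div_n -mulrDl e2 divff// sqrf_eq0 gt_eqF.
    have x1 : -1 <= x <= 1 by apply/andP; split; nra.
    have zx : z.1 = r * x by rewrite /x mulrC divfK// gt_eqF.
    have zy : z.2 = r * y by rewrite /y mulrC divfK// gt_eqF.
    have cx : cos (acos x) = x by rewrite acosK// in_itv.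
    have sx : sin (acos x) = `|y|.
      by rewrite sin_acos// -sqrtr_sqr; congr Num.sqrt; lra.
    have [y0|y0] := leP 0 y.
      exists (acos x) => //; rewrite cx sx ger0_norm// -zx -zy.
      by case: (z).
    exists (- acos x) => //; rewrite cosN sinN cx sx ltr0_norm// opprK -zx -zy.
    by case: (z).
  move=> [t _ <-]; rewrite /std_circle /sqnorm /= !exprMn -mulrDr cos2Dsin2.
  by rewrite mulr1 r2 mulrC divfK// gt_eqF// pi_gt0.
apply: connected_continuous_connected.
  by apply/connected_intervalP => x y _ _ z _.
apply: continuous_subspaceT => t.
apply: (@cvg_pair _ _ _ _ (nbhs (r * cos t)) (nbhs (r * sin t))).
- by apply: cvgMl_tmp; exact: continuous_cos.
- by apply: cvgMl_tmp; exact: continuous_sin.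
Qed.

End PlaneTopology.

(** * Area: invariance under shears and dyadic cells *)

Section PlaneArea.
Context {R : realType}.
Local Notation P := (measurableTypeR R * measurableTypeR R)%type.
Local Notation leb := (@lebesgue_measure R).

Lemma lebesgue_measure_shift (c : R) (A : set R) : measurable A ->
  leb ((fun x => x + c) @^-1` A) = leb A.
Proof.
move=> mA; have mf : measurable_fun [set: R] (fun x : R => x + c : measurableTypeR R).
  exact: measurable_funD.
apply/esym; apply: (@lebesgue_measure_unique _
  (pushforward leb (fun x : R => x + c : measurableTypeR R))) mA.
move=> _ [[a b]] _ <-.
rewrite [RHS](_ : _ = leb `]a - c, b - c]%classic); last first.
  rewrite /pushforward; congr (leb _).
  by apply/seteqP; split=> x /=; rewrite !in_itv/= ltrBlDr lerBrDr.
rewrite !lebesgue_measure_itv/= !lte_fin ltrD2r.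
by case: ifP => // _; congr (_%:E); ring.
Qed.

Lemma area_ysection (A : set P) : measurable A ->
  area A = (\int[leb]_y leb (ysection A y))%E.
Proof.
move=> mA; rewrite /area.
transitivity ((leb \x^ leb)%E A); last by [].
by apply: product_measure_unique => // B C mB mC/=; rewrite product_measure2E.
Qed.

Lemma measurable_shear1 (g : R -> R) : measurable_fun setT g ->
  measurable_fun [set: P] (fun z : P => (z.1 + g z.2, z.2) : P).
Proof.
move=> mg; apply: measurable_fun_pair; last exact: measurable_snd.
apply: measurable_funD; first exact: measurable_fst.
by apply: measurableT_comp => //; exact: measurable_snd.
Qed.

Lemma measurable_shear2 (g : R -> R) : measurable_fun setT g ->
  measurable_fun [set: P] (fun z : P => (z.1, z.2 + g z.1) : P).
Proof.
move=> mg; apply: measurable_fun_pair; first exact: measurable_fst.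
apply: measurable_funD; first exact: measurable_snd.
by apply: measurableT_comp => //; exact: measurable_fst.
Qed.

(** On each horizontal line the shear is a translation, so slicing reduces the claim to translation
    invariance on the line. *)
Lemma area_shear1 (g : R -> R) (S : set P) : measurable_fun setT g ->
  measurable S -> area ((fun z => (z.1 + g z.2, z.2)) @^-1` S) = area S.
Proof.
move=> mg mS; rewrite !area_ysection//; last first.
  by rewrite -[X in measurable X]setTI; exact: (measurable_shear1 mg).
apply: eq_integral => y _.
rewrite -(@lebesgue_measure_shift (g y) (ysection S y)); last first.
  exact: measurable_ysection.
by congr (leb _); apply/seteqP; split=> x; rewrite /= /ysection /= !inE.
Qed.

Lemma area_shear2 (g : R -> R) (S : set P) : measurable_fun setT g ->
  measurable S -> area ((fun z => (z.1, z.2 + g z.1)) @^-1` S) = area S.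
Proof.
move=> mg mS; rewrite /area /product_measure1.
apply: eq_integral => y _ /=.
rewrite -(@lebesgue_measure_shift (g y) (xsection S y)); last first.
  exact: measurable_xsection.
by congr (leb _); apply/seteqP; split=> x; rewrite /= /xsection /= !inE.
Qed.

Definition affine (p q r t c d : R) (z : R * R) : R * R :=
  (p * z.1 + q * z.2 + c, r * z.1 + t * z.2 + d).

Lemma measurable_affine (p q r t c d : R) :
  measurable_fun [set: P] (affine p q r t c d : P -> P).
Proof.
have h (a b e : R) : measurable_fun [set: P] (fun z : P => a * z.1 + b * z.2 + e).
  apply: measurable_funD => //; apply: measurable_funD; apply: measurable_funM => //.
exact: (measurable_fun_pair (h p q c) (h r t d)).
Qed.

(* A matrix of determinant 1 with q != 0 is a product of three shears; the case
   q = 0 is reduced to this one by one more shear. *)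
Lemma area_affine (p q r t c d : R) (S : set P) : p * t - q * r = 1 ->
  measurable S -> area (affine p q r t c d @^-1` S) = area S.
Proof.
have lin (a b : R) : measurable_fun [set: R] (fun x : R => a * x + b).
  by apply: measurable_funD => //; exact: measurable_funM.
wlog q0 : p q r t c d S / q != 0.
  move=> hw; have [->|] := eqVneq q 0; last exact: hw.
  move=> det mS; have p0 : p != 0.
    by apply/eqP => p0; move: det; rewrite p0 !mul0r subr0 => /eqP; rewrite eq_sym oner_eq0.
  rewrite -(@area_shear1 (fun y => 1 * y + 0))//; last first.
    rewrite -[X in measurable X]setTI.
    exact: (measurable_affine p 0 r t c d).
  have det' : p * (r + t) - p * r = 1 by rewrite -[RHS]det; ring.
  rewrite -(hw p p r (r + t) c d S p0 det' mS).
  have -> : affine p p r (r + t) c d =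
      affine p 0 r t c d \o (fun z => (z.1 + (1 * z.2 + 0), z.2)).
    by apply/funext => z; rewrite /affine /=; congr pair; ring.
  by rewrite comp_preimage.
move=> det mS.
(* The product of the lower shear by [e], the upper shear by [q] and the lower shear by [a] has
   diagonal entries [1 + q * a] and [1 + q * e] and upper right entry [q]; the determinant fixes the
   last entry. *)
pose a := (p - 1) / q; pose e := (t - 1) / q.
rewrite -[RHS](@area_shear2 (fun x => e * x + (d - e * c)) S)//.
rewrite -[RHS](@area_shear1 (fun y => q * y + c)) //; last first.
  rewrite -[X in measurable X]setTI.
  exact: (measurable_shear2 (lin e (d - e * c))).
rewrite -[RHS](@area_shear2 (fun x => a * x + 0)) //; last first.
  rewrite -[X in measurable X]setTI.
  apply: (measurable_shear1 (lin q c)) => //.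
  rewrite -[X in measurable X]setTI.
  exact: (measurable_shear2 (lin e (d - e * c))).
suff -> : affine p q r t c d =
    (fun z => (z.1, z.2 + (e * z.1 + (d - e * c)))) \o
    (fun z => (z.1 + (q * z.2 + c), z.2)) \o
    (fun z => (z.1, z.2 + (a * z.1 + 0))) by rewrite !comp_preimage.
apply/funext => z; rewrite /affine /=; congr pair.
  by rewrite /a; field.
have -> : r = (p * t - 1) / q.
  by apply: (mulIf q0); rewrite divfK//; move: det; lra.
by rewrite /a /e; field.
Qed.

Lemma area_box (a b c d : R) : a <= b -> c <= d ->
  area (`[a, b] `*` `[c, d]) = ((b - a) * (d - c))%:E.
Proof.
move=> ab cd; rewrite /area product_measure1E//.
have h (x y : R) : x <= y -> leb `[x, y]%classic = (y - x)%:E.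
  move=> xy; rewrite lebesgue_measure_itv/= lte_fin.
  case: ltP => // yx; congr (_%:E); apply/esym/eqP; rewrite subr_eq0; exact/eqP/le_anti/andP.
by rewrite [X in (X * _)%E]h// [X in (_ * X)%E]h.
Qed.

End PlaneArea.

(** * Dyadic squares and comparison of measures on open sets *)

Section DyadicCells.
Context {R : realType}.
Local Notation P := (measurableTypeR R * measurableTypeR R)%type.
Local Notation leb := (@lebesgue_measure R).
Local Notation areaM := (leb \x leb)%E.

Definition dyadic_index (n : nat) (z : R * R) : int * int :=
  (Num.floor (2 ^+ n * z.1), Num.floor (2 ^+ n * z.2)).

(* Cells of side 2^-n are numbered by a code in nat, so that unions of cells
   are countable unions; a number that codes no pair gives the empty set. *)
Definition dyadic_cell (n m : nat) : set (R * R) :=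
  [set z | pickle (dyadic_index n z) = m].

(** An approximation of [B] from inside; for open [B] it exhausts [B] as [n] grows. *)
Definition dyadic_hull (n : nat) (B : set (R * R)) : set (R * R) :=
  \bigcup_(m in [set m | dyadic_cell n m `<=` B]) dyadic_cell n m.

Let dyad_gt0 n : 0 < 2 ^+ n :> R. Proof. exact: exprn_gt0. Qed.

Lemma dyadic_cellE n z : dyadic_cell n (pickle (dyadic_index n z)) =
  `[(Num.floor (2 ^+ n * z.1))%:~R / 2 ^+ n,
    (Num.floor (2 ^+ n * z.1))%:~R / 2 ^+ n + 2 ^- n[ `*`
  `[(Num.floor (2 ^+ n * z.2))%:~R / 2 ^+ n,
    (Num.floor (2 ^+ n * z.2))%:~R / 2 ^+ n + 2 ^- n[.
Proof.
have e (u : R) (i : int) : (Num.floor (2 ^+ n * u) == i) =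
    (i%:~R / 2 ^+ n <= u < i%:~R / 2 ^+ n + 2 ^- n).
  rewrite floor_eq intrD ler_pdivrMr// mulrC; congr andb.
  by rewrite -{2}[2 ^- n]mul1r -mulrDl ltr_pdivlMr// mulrC.
apply/seteqP; split=> w.
  move=> /(pcan_inj pickleK) [/eqP + /eqP]; rewrite !e.
  by move=> ? ?; split; rewrite /= in_itv.
move=> [/=]; rewrite !in_itv/= -!e => /eqP h1 /eqP h2.
by rewrite /dyadic_cell /= /dyadic_index h1 h2.
Qed.

Lemma dyadic_cell_cases n m : dyadic_cell n m = set0 \/
  exists2 z, dyadic_cell n m z & dyadic_cell n m =
    `[z.1, z.1 + 2 ^- n[ `*` `[z.2, z.2 + 2 ^- n[.
Proof.
have [|/set0P [w wm]] := eqVneq (dyadic_cell n m) set0; [by left|right].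
pose z : R * R := ((Num.floor (2 ^+ n * w.1))%:~R / 2 ^+ n,
                   (Num.floor (2 ^+ n * w.2))%:~R / 2 ^+ n).
move: wm => <-; exists z; last exact: dyadic_cellE.
rewrite [X in X z]dyadic_cellE.
by split; rewrite /= in_itv/= lexx ltrDl invr_gt0 dyad_gt0.
Qed.

Lemma measurable_dyadic_cell n m : measurable (dyadic_cell n m : set P).
Proof.
have [->|[z _ ->]] := dyadic_cell_cases n m; first exact: measurable0.
exact: measurableX.
Qed.

Lemma area_dyadic_cell n m : dyadic_cell n m !=set0 ->
  area (dyadic_cell n m) = (2 ^- n * 2 ^- n)%:E.
Proof.
have [->|[z _ ->] _] := dyadic_cell_cases n m; first by case.
rewrite /area product_measure1E//.
have h (x : R) : leb `[x, x + 2 ^- n[%classic = (2 ^- n)%:E.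
  rewrite lebesgue_measure_itv/= lte_fin ltrDl invr_gt0 dyad_gt0 -EFinB.
  by congr (_%:E); ring.
by rewrite [X in (X * _)%E]h [X in (_ * X)%E]h -EFinM.
Qed.

Lemma trivIset_dyadic_cell n D : trivIset D (dyadic_cell n).
Proof. by move=> i j _ _ [z [<- <-]]. Qed.

Lemma measurable_dyadic_hull n B : measurable (dyadic_hull n B : set P).
Proof. by apply: bigcup_measurable => m _; exact: measurable_dyadic_cell. Qed.

Lemma dyadic_hull_sub n B : dyadic_hull n B `<=` B.
Proof. by move=> z [m /= mB /mB]. Qed.

(** The floor of [u] is half the floor of [2 * u], rounded down, so the finer index determines the
    coarser one. *)
Lemma dyadic_refine n z w : dyadic_index n.+1 z = dyadic_index n.+1 w ->
  dyadic_index n z = dyadic_index n w.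
Proof.
have h (x y : R) : Num.floor (2 ^+ n.+1 * x) = Num.floor (2 ^+ n.+1 * y) ->
    Num.floor (2 ^+ n * x) = Num.floor (2 ^+ n * y).
  rewrite !exprS -!mulrA; set u := 2 ^+ n * x; set v := 2 ^+ n * y => uv.
  apply/esym/floor_def.
  have /andP[u1 u2] := floor_itv u; have /andP[v1 v2] := floor_itv (2 * v).
  have [j1 j2] : 2 * Num.floor u <= Num.floor (2 * v) /\
                 Num.floor (2 * v) < 2 * (Num.floor u + 1).
    rewrite -uv; split.
      rewrite floor_ge_int intrM; move: u1; lra.
    rewrite floor_lt_int intrM; move: u2; lra.
  move: j1 j2 v1 v2; set k := Num.floor (2 * v) => j1 j2 v1 v2.
  have j3 : (2 * Num.floor u)%:~R <= k%:~R :> R by rewrite ler_int.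
  have j4 : (k + 1)%:~R <= (2 * (Num.floor u + 1))%:~R :> R by rewrite ler_int; lia.
  by apply/andP; split; move: v1 v2 j3 j4; rewrite !intrM !intrD; lra.
by move=> [/h h1 /h h2]; rewrite /dyadic_index h1 h2.
Qed.

Lemma dyadic_hull_nondecreasing B :
  {homo (fun n => dyadic_hull n B) : n m / (n <= m)%N >-> (n <= m)%O}.
Proof.
apply: homo_leq => //; first by move=> ? ? ?; exact: le_trans.
move=> n; apply/subsetPset => z [m /= sub mz]; move: mz sub => <- sub.
exists (pickle (dyadic_index n.+1 z)) => // w.
move=> /(pcan_inj pickleK) /dyadic_refine e; apply: sub.
by rewrite /dyadic_cell /= e.
Qed.

Lemma bigcup_dyadic_hull B : open B -> \bigcup_n dyadic_hull n B = B.
Proof.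
move=> oB; apply/seteqP; split=> z; first by move=> [n _]; exact: dyadic_hull_sub.
move=> Bz; have /nbhs_ballP[e /= e0 eB] : nbhs z B by exact: open_nbhs_nbhs.
have [n ne] : exists n, 2 ^- n < e.
  exists (Num.truncn e^-1).+1.
  rewrite invf_plt ?posrE//; apply: lt_trans (truncnS_gt _) _.
  by rewrite -natrX ltr_nat ltn_expl.
exists n => //; exists (pickle (dyadic_index n z)) => //= w.
have := dyadic_cellE n z => E; have : dyadic_cell n (pickle (dyadic_index n z)) z by [].
rewrite E => -[/=]; rewrite !in_itv/= => /andP[h1 h2] /andP[h3 h4].
move=> [/andP[h5 h6] /andP[h7 h8]].
by apply: eB; split; rewrite /ball /= ltr_norml; apply/andP; split; lra.
Qed.

Lemma measurable_open_plane (B : set (R * R)) : open B -> measurable (B : set P).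
Proof.
move=> oB; rewrite -(bigcup_dyadic_hull oB).
by apply: bigcupT_measurable => n; exact: measurable_dyadic_hull.
Qed.

Lemma continuous_measurable_plane (h : R * R -> R) : continuous h ->
  measurable_fun [set: P] (h : P -> measurableTypeR R).
Proof.
move=> ch; apply: (measurability _ (measurable_realfun.RGenOpens.measurableE R)).
move=> _ [_ [a [b ->]] <-]; rewrite setTI; apply: measurable_open_plane.
by apply: open_comp => [? _|]; [exact: ch|exact: interval_open].
Qed.

Lemma continuous_measurable_plane2 (g : R * R -> R * R) : continuous g ->
  measurable_fun [set: P] (g : P -> P).
Proof.
move=> cg; apply/measurable_fun_pairP; split;
  apply: continuous_measurable_plane => z.
- by apply: continuous_comp; [exact: cg|exact: cvg_fst].
- by apply: continuous_comp; [exact: cg|exact: cvg_snd].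
Qed.

(** The estimate on cells is summed over [dyadic_hull n B]; then [n] tends to infinity by continuity
    from below, and [e] tends to 0, which is harmless since [mu B] is finite. *)
Lemma le_measure_dyadic (mu nu : {measure set P -> \bar R}) (B : set (R * R)) :
  open B -> (mu B < +oo)%E ->
  (forall e : R, 0 < e -> exists N, forall n m, (N <= n)%N ->
     dyadic_cell n m `<=` B ->
     (nu (dyadic_cell n m) <= (1 + e)%:E * mu (dyadic_cell n m))%E) ->
  (nu B <= mu B)%E.
Proof.
move=> oB fB H.
have key (e : R) : 0 < e -> (nu B <= (1 + e)%:E * mu B)%E.
  move=> e0; have [N HN] := H e e0.
  have hull n : (N <= n)%N -> (nu (dyadic_hull n B) <= (1 + e)%:E * mu B)%E.
    move=> Nn; rewrite measure_bigcup /=; last 2 first.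
    - by move=> i _; exact: measurable_dyadic_cell.
    - exact: trivIset_dyadic_cell.
    apply: (@le_trans _ _ (\sum_(0 <= i <oo | i \in [set m | dyadic_cell n m `<=` B])
         (1 + e)%:E * mu (dyadic_cell n i))%E).
      apply: lee_nneseries => [i _ _|i]; first exact: measure_ge0.
      by rewrite inE /= => iB; exact: HN.
    rewrite nneseriesZl; last by move=> i _; exact: measure_ge0.
    rewrite lee_pmul2l//; last by rewrite lte_fin; lra.
    rewrite -measure_bigcup //; last 2 first.
    - by move=> i _; exact: measurable_dyadic_cell.
    - exact: trivIset_dyadic_cell.
    apply: le_measure; rewrite ?inE.
    - exact: measurable_dyadic_hull.
    - exact: measurable_open_plane.
    - exact: dyadic_hull_sub.
  have cv : nu (dyadic_hull n B) @[n --> \oo] --> nu B.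
    rewrite -[X in _ --> nu X](bigcup_dyadic_hull oB).
    apply: nondecreasing_cvg_mu.
    - by move=> n; exact: measurable_dyadic_hull.
    - by apply: bigcupT_measurable => n; exact: measurable_dyadic_hull.
    - exact: dyadic_hull_nondecreasing.
  apply: (cvge_le _ cv); exists N => // n /= Nn; exact: hull.
have fin : mu B \is a fin_num by rewrite ge0_fin_numE.
have [a a0 E] : exists2 a : R, 0 <= a & mu B = a%:E.
  exists (fine (mu B)); last by rewrite fineK.
  by apply: fine_ge0; exact: measure_ge0.
rewrite E; apply/lee_addgt0Pr => e e0.
(* The relative error is taken to be [e / (a + 1)], because [a] may be 0. *)
have a1 : 0 < a + 1 by lra.
apply: le_trans (key _ (divr_gt0 e0 a1)) _.
rewrite E -EFinM -EFinD lee_fin mulrDl mul1r lerD2l.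
by rewrite mulrAC ler_pdivrMr// ler_pM2l//; lra.
Qed.

(** Images under [f] are preimages under [g], so the area of the image is a pushforward measure and
    can be compared with area. *)
Lemma area_image_le_dyadic (f g : R * R -> R * R) (B : set (R * R)) :
  cancel f g -> cancel g f -> continuous g -> open B -> (area B < +oo)%E ->
  (forall e : R, 0 < e -> exists N, forall n m, (N <= n)%N ->
     dyadic_cell n m `<=` B ->
     (area (f @` dyadic_cell n m) <= (1 + e)%:E * area (dyadic_cell n m))%E) ->
  (area (f @` B) <= area B)%E.
Proof.
move=> fK gK cg oB fB H.
rewrite (image_can2 _ fK gK).
apply: (@le_measure_dyadic areaM (pushforward areaM (g : P -> P))) => //.
  exact: continuous_measurable_plane2.
move=> mg e /H[N HN]; exists N => n m Nn mB.
by have := HN n m Nn mB; rewrite (image_can2 _ fK gK).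
Qed.

End DyadicCells.

(** * Area of the disk *)

Section DiskArea.
Context {R : realType}.
Local Notation leb := (@lebesgue_measure R).

Lemma integral_half_disk (r : R) : 0 < r ->
  (\int[leb]_(x in `[(- r)%R, r]) (2 * Num.sqrt (r ^+ 2 - x ^+ 2))%:E =
   (r ^+ 2 * pi)%:E)%E.
Proof.
move=> r0; pose F (t : R) := r * sin t.
have pi0 : 0 < pi :> R by exact: pi_gt0.
have dF (t : R) : is_derive t 1 F (r * cos t).
  have h := is_derive_sin t.
  by rewrite -[r * cos t]/(r *: cos t); exact: is_deriveZ.
have F' : derive1 F = (fun t => r * cos t).
  by apply/funext => t; rewrite derive1E; exact: derive_val.
have cF : continuous F.
  move=> t; apply: differentiable_continuous; apply/derivable1_diffP.
  by have [] := dF t.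
have cF' : continuous (fun t : R => r * cos t).
  by move=> t; apply: cvgMl_tmp; exact: continuous_cos.
have -> : - r = F (- (pi / 2)) by rewrite /F sinN sin_pihalf mulrN mulr1.
have -> : `[F (- (pi / 2)), r]%classic = `[F (- (pi / 2)), F (pi / 2)]%classic.
  by rewrite /F sin_pihalf mulr1.
rewrite (@integration_by_substitution_increasing _ F
  (fun x => 2 * Num.sqrt (r ^+ 2 - x ^+ 2))); first last.
- apply: continuous_subspaceT => x; apply: cvgMl_tmp.
  apply: continuous_comp; last exact: sqrt_continuous.
  by apply: cvgB; [exact: cvg_cst|exact: exprn_continuous].
- split.
  + by move=> t _; have [] := dF t.
  + by apply: cvg_at_right_filter; exact: cF.
  + by apply: cvg_at_left_filter; exact: cF.
- by rewrite F'; apply/cvg_ex; exists (r * cos (pi / 2));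
    apply: cvg_at_left_filter; exact: cF'.
- by rewrite F'; apply/cvg_ex; exists (r * cos (- (pi / 2)));
    apply: cvg_at_right_filter; exact: cF'.
- by rewrite F' => t _; exact: cF'.
- by move=> t u tI uI tu; rewrite /F ltr_pM2l// ltr_sin.
- lra.
(* The substitution x = r sin t turns the integrand into 2 r^2 cos^2 t. *)
pose G (t : R) := r ^+ 2 * (t + sin t * cos t).
have dG (t : R) : is_derive t 1 G (r ^+ 2 * (2 * cos t ^+ 2)).
  have hs := is_derive_sin t; have hc := is_derive_cos t.
  rewrite -[r ^+ 2 * _]/(r ^+ 2 *: _); apply: is_deriveZ.
  have -> : 2 * cos t ^+ 2 = 1 + (sin t *: (- sin t) + cos t *: cos t).
    have := cos2Dsin2 t; rewrite -[_ *: _]/(_ * _) -[cos t *: _]/(_ * _).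
    by rewrite !expr2; lra.
  by apply: is_deriveD; exact: is_deriveM.
have cG : continuous G.
  move=> t; apply: differentiable_continuous; apply/derivable1_diffP.
  by have [] := dG t.
rewrite (_ : (\int[_]_(x in _) _)%E =
  (\int[leb]_(t in `[(- (pi / 2))%R, (pi / 2)%R]) (r ^+ 2 * (2 * cos t ^+ 2))%:E)%E); last first.
  apply: eq_integral => t; rewrite inE /= in_itv/= => tI.
  congr (_%:E); rewrite F'.
  rewrite -[LHS]/(2 * Num.sqrt (r ^+ 2 - (r * sin t) ^+ 2) * (r * cos t)).
  rewrite exprMn -{1}[r ^+ 2]mulr1 -mulrBr -cos2sin2 sqrtrM ?sqr_ge0//.
  rewrite !sqrtr_sqr ger0_norm ?(ltW r0)// ger0_norm; first by ring.
  exact: cos_ge0_pihalf.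
rewrite (@continuous_FTC2 _ _ G).
- rewrite /G sinN cosN sin_pihalf cos_pihalf -EFinB; congr (_%:E).
  by field.
- lra.
- apply: continuous_subspaceT => t; apply: cvgMl_tmp; apply: cvgMl_tmp.
  apply: (@continuous_comp _ _ _ cos (fun x : R => x ^+ 2)).
    exact: continuous_cos.
  exact: exprn_continuous.
- split.
  + by move=> t _; have [] := dG t.
  + by apply: cvg_at_right_filter; exact: cG.
  + by apply: cvg_at_left_filter; exact: cG.
- by move=> t _; rewrite derive1E; exact: derive_val.
Qed.

Lemma area_std_disk (b : R) : 0 < b -> area (std_disk b) = b%:E.
Proof.
move=> b0; pose r := Num.sqrt (b / pi).
have pi0 : 0 < pi :> R by exact: pi_gt0.
have bp0 : 0 < b / pi by rewrite divr_gt0.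
have r2 : r ^+ 2 = b / pi by rewrite sqr_sqrtr// ltW.
have r0 : 0 < r by rewrite sqrtr_gt0.
transitivity (\int[leb]_(x in `[(- r)%R, r]) (2 * Num.sqrt (r ^+ 2 - x ^+ 2))%:E)%E; last first.
  by rewrite integral_half_disk// r2 divfK// gt_eqF.
rewrite /area /product_measure1 [RHS]integral_mkcond.
apply: eq_integral => x _ /=.
have -> : xsection (std_disk b) x =
    `]- Num.sqrt (r ^+ 2 - x ^+ 2), Num.sqrt (r ^+ 2 - x ^+ 2)[%classic.
  apply/seteqP; split=> y; rewrite /xsection /= in_itv/= -ltr_norml -sqrtr_sqr.
    rewrite inE /std_disk /sqnorm /= mulrC -ltr_pdivlMr// -r2 => h.
    by rewrite ltr_sqrt; [lra|have := sqr_ge0 y; lra].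
  move=> h; rewrite inE /std_disk /sqnorm /= mulrC -ltr_pdivlMr// -r2.
  have p : 0 < r ^+ 2 - x ^+ 2.
    by rewrite -sqrtr_gt0; apply: le_lt_trans h; exact: sqrtr_ge0.
  by move: h; rewrite ltr_sqrt//; lra.
have s0 := sqrtr_ge0 (r ^+ 2 - x ^+ 2).
rewrite lebesgue_measure_itv/= lte_fin patchE.
have [xr|xr] := boolP (x \in `[- r, r]%classic).
  case: ltP => h; first by rewrite -EFinB; congr (_%:E); ring.
  by congr (_%:E); lra.
(* Outside [[- r, r]] the radicand is negative and [Num.sqrt] takes its default value 0, so the
   slice is empty. *)
have -> : Num.sqrt (r ^+ 2 - x ^+ 2) = 0.
  apply/eqP; rewrite sqrtr_eq0; rewrite leNgt; apply/negP => h.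
  move/negP: xr; apply; rewrite inE /= in_itv/= -ler_norml.
  by rewrite -(ger0_norm (ltW r0)) -ler_sqr ?nnegrE// !real_normK ?num_real//; lra.
by rewrite oppr0 ltxx.
Qed.

End DiskArea.

(** * Calculus *)

Section Calculus.
Context {R : realType}.

Lemma is_derive_along (V W : normedModType R) (f : V -> W) (z v : V) (t : R) :
  forall d, is_derive (z + t *: v) v f d ->
  is_derive t (1 : R) (fun s => f (z + s *: v)) d.
Proof.
move=> d [df <-].
have E : (fun h : R => h^-1 *: (((fun s => f (z + s *: v)) \o shift t) (h *: (1 : R))
      - f (z + t *: v))) =
    (fun h : R => h^-1 *: ((f \o shift (z + t *: v)) (h *: v) - f (z + t *: v))).
  apply/funext => h; congr (_ *: (f _ - _)) => /=.
  by rewrite -[h *: 1]/(h * 1) mulr1 scalerDl addrCA addrA addrAC.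
apply: DeriveDef; first by rewrite /derivable E.
by rewrite /derive E.
Qed.

Lemma is_derive_fst (V W1 W2 : normedModType R) (f : V -> W1 * W2) z v d :
  is_derive z v f d -> is_derive z v (fst \o f) d.1.
Proof.
move=> [df <-].
have cv : h^-1 *: ((fst \o f \o shift z) (h *: v) - (fst \o f) z) @[h --> 0^'] -->
    ('D_v f z).1.
  apply: (@cvg_comp _ _ _ (fun h : R => h^-1 *: ((f \o shift z) (h *: v) - f z)) fst
    _ _ _ df).
  exact: cvg_fst.
by apply: DeriveDef; [apply/cvg_ex; eexists; exact: cv|exact: cvg_lim cv].
Qed.

Lemma is_derive_snd (V W1 W2 : normedModType R) (f : V -> W1 * W2) z v d :
  is_derive z v f d -> is_derive z v (snd \o f) d.2.
Proof.
move=> [df <-].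
have cv : h^-1 *: ((snd \o f \o shift z) (h *: v) - (snd \o f) z) @[h --> 0^'] -->
    ('D_v f z).2.
  apply: (@cvg_comp _ _ _ (fun h : R => h^-1 *: ((f \o shift z) (h *: v) - f z)) snd
    _ _ _ df).
  exact: cvg_snd.
by apply: DeriveDef; [apply/cvg_ex; eexists; exact: cv|exact: cvg_lim cv].
Qed.

Lemma pair_ext (T U : Type) (a b : T * U) : a.1 = b.1 -> a.2 = b.2 -> a = b.
Proof. by case: a b => [? ?] [? ?] /= -> ->. Qed.

Lemma mvt_linear (g dg : R -> R) (c e a : R) :
  (forall t, `|t| <= `|a| -> is_derive t (1 : R) g (dg t)) ->
  (forall t, `|t| <= `|a| -> `|dg t - c| <= e) ->
  `|g a - g 0 - c * a| <= e * `|a|.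
Proof.
move=> dG dgc.
have cg (x y : R) : (forall t, t \in `[x, y] -> `|t| <= `|a|) ->
    {within `[x, y], continuous g}.
  move=> xy; apply: derivable_within_continuous => t /xy/dG h.
  by have [] := h.
have [a0|a0|<-] := ltgtP 0 a; last first.
- by rewrite subrr mulr0 subrr normr0 mulr0.
- have H t : t \in `[a, 0] -> `|t| <= `|a|.
    by rewrite in_itv/= => /andP[h1 h2]; rewrite !ler0_norm//; lra.
  have [t tI] := MVT a0 (fun t tI => dG t (H t (subset_itv_oo_cc tI))) (cg _ _ H).
  move=> E; have -> : g a - g 0 - c * a = (dg t - c) * a.
    by move: E; rewrite sub0r; lra.
  by rewrite normrM ler_wpM2r// dgc// H// (subset_itv_oo_cc tI).
- have H t : t \in `[0, a] -> `|t| <= `|a|.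
    by rewrite in_itv/= => /andP[h1 h2]; rewrite !ger0_norm//; lra.
  have [t tI] := MVT a0 (fun t tI => dG t (H t (subset_itv_oo_cc tI))) (cg _ _ H).
  move=> ->; have -> : dg t * (a - 0) - c * a = (dg t - c) * a by ring.
  by rewrite normrM ler_wpM2r// dgc// H// (subset_itv_oo_cc tI).
Qed.

(** Uniform continuity around [K], where [z + u] may leave [K]: the covering form of compactness is
    applied to a difference that vanishes at [u = 0]. *)
Lemma near_shift_bound (V : normedModType R) (p : V -> R) (K : set V) (e : R) :
  continuous p -> compact K -> 0 < e ->
  exists2 d : R, 0 < d &
    forall z u, K z -> `|u| <= d -> `|p (z + u) - p z| <= e.
Proof.
move=> cp /compact_near_coveringP cK e0.
have : \forall u \near (0 : V), K `<=` (fun z => `|p (z + u) - p z| <= e).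
  apply: cK => z Kz.
  have cv : (fun x : V * V => p (x.1 + x.2) - p x.1) x @[x --> (z, 0)] --> p (z + 0) - p z.
    apply: cvgB.
      have h : (fun x : V * V => x.1 + x.2) x @[x --> (z, 0)] --> z + 0.
        by apply: cvgD; [exact: cvg_fst|exact: cvg_snd].
      exact: (cvg_comp _ _ h (cp _)).
    have h : (fun x : V * V => x.1) x @[x --> (z, 0 : V)] --> z by exact: cvg_fst.
    exact: (cvg_comp _ _ h (cp _)).
  rewrite addr0 subrr in cv.
  have /cvgr0_norm_le/(_ e e0) := cv.
  exact.
move=> /nbhs_norm0P[d /= d0 dK]; exists (d / 2); first by rewrite divr_gt0.
move=> z u Kz ud; apply: (dK u) => //=.
by rewrite (le_lt_trans ud)// ltr_pdivrMr// ltr_pMr// ltr1n.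
Qed.

Lemma compact_norm_bound (T : topologicalType) (p : T -> R) (K : set T) :
  continuous p -> compact K -> exists2 C, 0 <= C & forall y, K y -> `|p y| <= C.
Proof.
move=> cp cK; have [C [_ h]] : bounded_set (p @` K).
  apply: compact_bounded; apply: continuous_compact => //.
  exact: continuous_subspaceT.
exists (`|C| + 1) => [|y Ky]; first by rewrite addr_ge0.
by apply: h; [rewrite (le_lt_trans (ler_norm C))// ltrDl|exists y].
Qed.

(** The segment from [z] to [z + w] is replaced by a vertical leg followed by a horizontal one, with
    [mvt_linear] on each leg. *)
Lemma taylor1 (f f1 f2 : R * R -> R) (z w : R * R) (e : R) :
  (forall x : R * R, is_derive x (1, 0) f (f1 x)) ->
  (forall x : R * R, is_derive x (0, 1) f (f2 x)) ->
  (forall u, `|u| <= `|w| -> `|f1 (z + u) - f1 z| <= e) ->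
  (forall u, `|u| <= `|w| -> `|f2 (z + u) - f2 z| <= e) ->
  `|f (z + w) - f z - (f1 z * w.1 + f2 z * w.2)| <=
    e * (`|w.1| + `|w.2|).
Proof.
move=> d1 d2 h1 h2.
have n1 : `|w.1| <= `|w| by rewrite prod_normE le_max lexx.
have n2 : `|w.2| <= `|w| by rewrite prod_normE le_max lexx orbT.
have m1 : `|f (z + (0, w.2) + w.1 *: (1, 0)) - f (z + (0, w.2) + 0 *: (1, 0))
    - f1 z * w.1| <= e * `|w.1|.
  apply: (@mvt_linear (fun s => f (z + (0, w.2) + s *: (1, 0)))
    (fun s => f1 (z + (0, w.2) + s *: (1, 0)))).
    by move=> t _; exact: is_derive_along.
  move=> t tw; rewrite -addrA; apply: h1.
  rewrite prod_normE /= -[t *: 1]/(t * 1) -[t *: 0]/(t * 0) mulr1 mulr0 add0r addr0.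
  by rewrite ge_max n2 (le_trans tw).
have m2 : `|f (z + w.2 *: (0, 1)) - f (z + 0 *: (0, 1)) - f2 z * w.2|
    <= e * `|w.2|.
  apply: (@mvt_linear (fun s => f (z + s *: (0, 1)))
    (fun s => f2 (z + s *: (0, 1)))).
    by move=> t _; exact: is_derive_along.
  move=> t tw; apply: h2.
  rewrite prod_normE /= -[t *: 1]/(t * 1) -[t *: 0]/(t * 0) mulr1 mulr0 normr0.
  by rewrite ge_max normr_ge0 (le_trans tw).
have E1 : z + (0, w.2) + w.1 *: (1, 0) = z + w.
  rewrite -addrA; congr (_ + _); apply: pair_ext => /=.
    by rewrite add0r -[_ *: _]/(_ * _) mulr1.
  by rewrite -[_ *: _]/(_ * _) mulr0 addr0.
have E2 : z + w.2 *: (0, 1) = z + (0, w.2).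
  congr (_ + _); apply: pair_ext => /=.
    by rewrite -[_ *: _]/(_ * _) mulr0.
  by rewrite -[_ *: _]/(_ * _) mulr1.
move: m1 m2; rewrite E1 E2 !scale0r !addr0 => m1 m2.
rewrite mulrDr; apply: le_trans (lerD m1 m2).
apply: le_trans (ler_normD _ _); rewrite le_eqVlt; apply/orP; left; apply/eqP.
by congr (`|_|); ring.
Qed.

End Calculus.

(** * Symmetry of second derivatives *)

Section Schwarz.
Context {R : realType} {V : normedModType R}.
Implicit Types (f : V -> R) (u v x : V).

(** The second difference is an increment in [a] of [g], whose derivative is in turn an increment of
    [f_u] along [v]; the mean value estimate is used at both levels. *)
Lemma second_difference f f_u f_uv u v x (c e h : R) :
  (forall y, is_derive y u f (f_u y)) ->
  (forall y, is_derive y v f_u (f_uv y)) ->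
  (forall a b : R, `|a| <= `|h| -> `|b| <= `|h| ->
    `|f_uv (x + a *: u + b *: v) - c| <= e) ->
  `|f (x + h *: u + h *: v) - f (x + h *: u) - f (x + h *: v) + f x - c * h * h|
    <= e * `|h| * `|h|.
Proof.
move=> fu fuv cl.
pose g (a : R) := f (x + h *: v + a *: u) - f (x + a *: u).
have := @mvt_linear R g (fun a => f_u (x + h *: v + a *: u) - f_u (x + a *: u))
  (c * h) (e * `|h|) h _ _.
rewrite /g scale0r !addr0 (addrAC x (h *: v)) => H.
apply: le_trans (H _ _).
- rewrite le_eqVlt; apply/orP; left; apply/eqP; congr (`|_|); ring.
- by move=> t _; apply: is_deriveB; apply: is_derive_along.
- move=> a ah.
  have := @mvt_linear R (fun b => f_u (x + a *: u + b *: v))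
    (fun b => f_uv (x + a *: u + b *: v)) c e h _ _.
  rewrite scale0r !addr0 (addrAC x (h *: v)); apply.
    by move=> t _; apply: is_derive_along.
  by move=> b bh; exact: cl.
Qed.

(** The second difference is symmetric in [u] and [v], and divided by [h * h] it is close to either
    mixed derivative. *)
Lemma schwarz_derive f f_u f_v f_uv f_vu u v :
  (forall y, is_derive y u f (f_u y)) -> (forall y, is_derive y v f (f_v y)) ->
  (forall y, is_derive y v f_u (f_uv y)) ->
  (forall y, is_derive y u f_v (f_vu y)) ->
  continuous f_uv -> continuous f_vu -> f_uv =1 f_vu.
Proof.
move=> fu fv fuv fvu cuv cvu x; apply/eqP; rewrite -subr_eq0 -normr_le0.
apply/ler_addgt0Pr => e e0; rewrite add0r.
have e2 : 0 < e / 2 by rewrite divr_gt0.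
have [d1 d10 H1] := near_shift_bound cuv (@compact_set1 _ x) e2.
have [d2 d20 H2] := near_shift_bound cvu (@compact_set1 _ x) e2.
pose d := Num.min d1 d2; have d0 : 0 < d by rewrite lt_min d10.
pose M := `|u| + `|v| + 1.
have M0 : 0 < M by rewrite /M ltr_wpDl// addr_ge0.
pose h := d / M; have h0 : 0 < h by rewrite divr_gt0.
have bnd (a b : R) : `|a| <= `|h| -> `|b| <= `|h| -> `|a *: u + b *: v| <= d.
  rewrite (ger0_norm (ltW h0)) => ah bh; apply: le_trans (ler_normD _ _) _.
  rewrite !normrZ; apply: (@le_trans _ _ (h * `|u| + h * `|v|)).
    by apply: lerD; exact: ler_wpM2r.
  rewrite -mulrDr -[leRHS](divfK (lt0r_neq0 M0)) -/h ler_pM2l//.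
  by rewrite /M lerDl.
have A1 : `|f (x + h *: u + h *: v) - f (x + h *: u) - f (x + h *: v) + f x
    - f_uv x * h * h| <= e / 2 * `|h| * `|h|.
  apply: second_difference fu fuv _ => a b ah bh; rewrite -addrA; apply: H1 => //.
  by apply: le_trans (bnd a b ah bh) _; rewrite ge_min lexx.
have A2 : `|f (x + h *: v + h *: u) - f (x + h *: v) - f (x + h *: u) + f x
    - f_vu x * h * h| <= e / 2 * `|h| * `|h|.
  apply: second_difference fv fvu _ => a b ah bh; rewrite -addrA; apply: H2 => //.
  by rewrite addrC; apply: le_trans (bnd b a bh ah) _; rewrite ge_min lexx orbT.
have hh : 0 < h * h by rewrite mulr_gt0.
rewrite -(ler_pM2r hh) -{1}(ger0_norm (ltW hh)) -normrM.
move: A1 A2; rewrite (addrAC x (h *: v)) (ger0_norm (ltW h0)).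
set D := f _; set D1 := f _; set D2 := f _ => A1 A2.
have -> : (f_uv x - f_vu x) * (h * h) = (D - D2 - D1 + f x - f_vu x * h * h) -
  (D - D1 - D2 + f x - f_uv x * h * h) by ring.
apply: le_trans (ler_normB _ _) _.
have -> : e * (h * h) = e / 2 * h * h + e / 2 * h * h by field.
exact: lerD.
Qed.

End Schwarz.

(** * Area of images under maps with Jacobian determinant 1 *)

Section AreaImage.
Context {R : realType}.
Local Notation P := (measurableTypeR R * measurableTypeR R)%type.
Local Notation areaM := (@lebesgue_measure R \x @lebesgue_measure R)%E.

Lemma ler_affine_comb (a b x y C m : R) : `|a| <= C -> `|b| <= C ->
  `|x| <= m -> `|y| <= m -> `|a * x + b * y| <= 2 * C * m.
Proof.
move=> aC bC xm ym; apply: le_trans (ler_normD _ _) _.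
rewrite !normrM -mulrA mulr2n mulrDl !mul1r; apply: lerD; exact: ler_pM.
Qed.

(* The inverse of the linear part preserves area and moves the image of the
   square into a square with sides longer by 4 C m. *)
Lemma area_image_square (f g : R * R -> R * R) (a b c d : R) (z : R * R)
    (C m l : R) :
  cancel f g -> cancel g f -> continuous g ->
  a * d - b * c = 1 -> `|a| <= C -> `|b| <= C -> `|c| <= C -> `|d| <= C ->
  0 <= m -> 0 <= l -> 0 <= C ->
  (forall x y, 0 <= x <= l -> 0 <= y <= l ->
    `|(f (z + (x, y))).1 - (f z).1 - (a * x + b * y)| <= m /\
    `|(f (z + (x, y))).2 - (f z).2 - (c * x + d * y)| <= m) ->
  (area (f @` (`[z.1, (z.1 + l)%R[ `*` `[z.2, (z.2 + l)%R[)) <=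
    ((l + 4 * C * m) ^+ 2)%:E)%E.
Proof.
move=> fK gK cg det aC bC cC dC m0 l0 C0 H.
pose k := 2 * C * m; have k0 : 0 <= k by rewrite /k !mulr_ge0.
pose box : set P := `[- k, l + k] `*` `[- k, l + k].
have mbox : measurable box by exact: measurableX.
(* [A] moves [f z] to the origin and then applies the inverse matrix, so [A (f w)] is [w - z] up to
   an error of at most [k] in each coordinate. *)
pose A := affine d (- b) (- c) a (- (d * (f z).1 - b * (f z).2))
  (- (a * (f z).2 - c * (f z).1)).
have detA : d * a - (- b) * (- c) = 1 by rewrite -[RHS]det; ring.
have -> : (((l + 4 * C * m) ^+ 2)%:E = area (A @^-1` box))%E.
  rewrite /A area_affine// area_box; [|lra|lra].
  by congr (_%:E); rewrite /k; ring.
apply: (@le_measure _ _ _ areaM); rewrite ?inE.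
- rewrite (image_can2 _ fK gK) -[X in measurable X]setTI.
  by apply: (continuous_measurable_plane2 cg) => //; exact: measurableX.
- by rewrite -[X in measurable X]setTI; apply: measurable_affine.
- move=> _ [w [+ +] <-]; rewrite /= !in_itv/= => /andP[w1 w1'] /andP[w2 w2'].
  have [] := H (w.1 - z.1) (w.2 - z.2) _ _; [by lra|by lra|].
  have -> : z + (w.1 - z.1, w.2 - z.2) = w by apply: pair_ext => /=; ring.
  set x := w.1 - z.1; set y := w.2 - z.2.
  set r1 := (f w).1 - _ - _; set r2 := (f w).2 - _ - _ => h1 h2.
  have e1 : `|d * r1 + (- b) * r2| <= k by apply: ler_affine_comb; rewrite ?normrN.
  have e2 : `|(- c) * r1 + a * r2| <= k by apply: ler_affine_comb; rewrite ?normrN.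
  have E1 : (A (f w)).1 = x + (d * r1 + (- b) * r2).
    apply/eqP; rewrite -subr_eq0; apply/eqP.
    transitivity (- x * (1 - (a * d - b * c))); last by rewrite det subrr mulr0.
    by rewrite /A /affine /= /r1 /r2; ring.
  have E2 : (A (f w)).2 = y + ((- c) * r1 + a * r2).
    apply/eqP; rewrite -subr_eq0; apply/eqP.
    transitivity (- y * (1 - (a * d - b * c))); last by rewrite det subrr mulr0.
    by rewrite /A /affine /= /r1 /r2; ring.
  move: e1 e2; rewrite !ler_norml => /andP[e1 e1'] /andP[e2 e2'].
  have B1 : - k <= (A (f w)).1 <= l + k by rewrite E1 /x; apply/andP; split; lra.
  have B2 : - k <= (A (f w)).2 <= l + k by rewrite E2 /y; apply/andP; split; lra.
  by split; rewrite /= in_itv.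
Qed.

Lemma area_image_le (f g : R * R -> R * R) (f11 f12 f21 f22 : R * R -> R)
    (B : set (R * R)) :
  cancel f g -> cancel g f -> continuous g ->
  (forall z : R * R, [/\ is_derive z (1, 0) (fst \o f) (f11 z),
                 is_derive z (0, 1) (fst \o f) (f12 z),
                 is_derive z (1, 0) (snd \o f) (f21 z) &
                 is_derive z (0, 1) (snd \o f) (f22 z)]) ->
  [/\ continuous f11, continuous f12, continuous f21 & continuous f22] ->
  (forall z, f11 z * f22 z - f12 z * f21 z = 1) ->
  open B -> bounded_set B -> (area B < +oo)%E ->
  (area (f @` B) <= area B)%E.
Proof.
move=> fK gK cg df [c11 c12 c21 c22] det oB bB fB.
have [M0 M00 BM] : exists2 M : R, 0 < M & forall z, B z -> `|z| <= M.
  have [M [_ h]] := bB; exists (`|M| + 1); first by rewrite ltr_wpDl.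
  by apply: h; rewrite (le_lt_trans (ler_norm M))// ltrDl.
pose K : set (R * R) := `[- M0, M0] `*` `[- M0, M0].
have BK : B `<=` K.
  move=> z /BM; rewrite prod_normE ge_max !ler_norml => /andP[h1 h2].
  by split; rewrite /= in_itv.
have cK : compact K by apply: compact_setX; exact: segment_compact.
have [C [C1 HC]] : exists C : R, 1 <= C /\ forall z, K z ->
    [/\ `|f11 z| <= C, `|f12 z| <= C, `|f21 z| <= C & `|f22 z| <= C].
  have [C1 C10 h1] := compact_norm_bound c11 cK.
  have [C2 C20 h2] := compact_norm_bound c12 cK.
  have [C3 C30 h3] := compact_norm_bound c21 cK.
  have [C4 C40 h4] := compact_norm_bound c22 cK.
  exists (1 + C1 + C2 + C3 + C4); split; first by lra.
  by move=> z Kz; move: (h1 z Kz) (h2 z Kz) (h3 z Kz) (h4 z Kz) => *; split; lra.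
apply: (area_image_le_dyadic fK gK cg oB fB) => e e0.
(* On a cell of side [l] the Taylor remainder is at most [eta * (2 * l)], so the enlarged square has
   side [l * (1 + 8 * k)]. As [k <= 1], the area grows by a factor of at most [1 + 80 * k], hence at
   most [1 + e]. *)
pose k := Num.min 1 (e / 80); pose eta := k / C.
have C0 : 0 < C by lra.
have k0 : 0 < k by rewrite lt_min ltr01 divr_gt0.
have [k1 ke] : k <= 1 /\ k <= e / 80 by split; rewrite /k ge_min lexx ?orbT.
have eta0 : 0 < eta by rewrite divr_gt0.
have [d1 d10 H1] := near_shift_bound c11 cK eta0.
have [d2 d20 H2] := near_shift_bound c12 cK eta0.
have [d3 d30 H3] := near_shift_bound c21 cK eta0.
have [d4 d40 H4] := near_shift_bound c22 cK eta0.
pose d := Num.min (Num.min d1 d2) (Num.min d3 d4).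
have d0 : 0 < d by rewrite !lt_min d10 d20 d30.
have [e1 e2 e3 e4] : [/\ d <= d1, d <= d2, d <= d3 & d <= d4].
  by split; rewrite /d !ge_min lexx ?orbT.
exists (Num.truncn d^-1).+1 => n m Nn mB.
pose l := 2 ^- n : R; have l0 : 0 < l by rewrite invr_gt0 exprn_gt0.
have ld : l <= d.
  rewrite invf_ple ?posrE ?exprn_gt0//; apply: ltW.
  apply: lt_trans (truncnS_gt _) _; rewrite -natrX ltr_nat.
  by apply: leq_ltn_trans Nn _; exact: ltn_expl.
have [->|[z zm cellE]] := @dyadic_cell_cases R n m.
  by rewrite image_set0 /area measure0 mule0.
have Kz : K z by exact/BK/mB.
have [a1 a2 a3 a4] := HC z Kz.
rewrite area_dyadic_cell; last by exists z.
rewrite cellE -/l.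
apply: le_trans (@area_image_square f g (f11 z) (f12 z) (f21 z) (f22 z) z
    C (eta * (2 * l)) l fK gK cg (det z) a1 a2 a3 a4 _ _ _ _) _.
- by rewrite mulr_ge0 ?(ltW eta0)// mulr_ge0// ltW.
- exact: ltW.
- exact: ltW.
- move=> x y /andP[x0 xl] /andP[y0 yl].
  have nxy : `|(x, y)| <= d.
    by rewrite prod_normE /= !ger0_norm// ge_max (le_trans xl)// (le_trans yl).
  have sm : eta * (`|x| + `|y|) <= eta * (2 * l).
    by rewrite ler_pM2l// !ger0_norm//; lra.
  split; apply: le_trans sm.
  + apply: (@taylor1 _ (fst \o f) f11 f12 z (x, y)) => [w|w|u ud|u ud].
    * by have [] := df w.
    * by have [] := df w.
    * by apply: H1 => //; rewrite (le_trans ud)// (le_trans nxy).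
    * by apply: H2 => //; rewrite (le_trans ud)// (le_trans nxy).
  + apply: (@taylor1 _ (snd \o f) f21 f22 z (x, y)) => [w|w|u ud|u ud].
    * by have [] := df w.
    * by have [] := df w.
    * by apply: H3 => //; rewrite (le_trans ud)// (le_trans nxy).
    * by apply: H4 => //; rewrite (le_trans ud)// (le_trans nxy).
- rewrite -EFinM lee_fin -/l.
  have -> : l + 4 * C * (eta * (2 * l)) = l * (1 + 8 * k).
    by rewrite /eta; field; rewrite gt_eqF.
  rewrite exprMn mulrC -expr2 ler_wpM2r ?sqr_ge0//.
  have -> : (1 + 8 * k) ^+ 2 = 1 + 16 * k + 64 * (k * k) by ring.
  have kk : k * k <= k by rewrite ler_piMr// ltW.
  lra.
Qed.

End AreaImage.

(** * Flows of divergence-free vector fields *)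

Section Flow.
Context {R : realType}.

(** The function [N t * expR (- k * t)] has nonpositive derivative inside the interval. *)
Lemma gronwall (N dN : R -> R) (k T : R) : 0 <= T ->
  (forall t, 0 <= t <= T -> is_derive t (1 : R) N (dN t)) ->
  (forall t, 0 < t < T -> dN t <= k * N t) ->
  N T <= N 0 * expR (k * T).
Proof.
move=> T0 dNP le.
have [->|Tn0] := eqVneq T 0; first by rewrite mulr0 expR0 mulr1.
have {}T0 : 0 < T by rewrite lt_def Tn0.
pose m (t : R) := N t * expR (- k * t).
pose dm (t : R) := (dN t - k * N t) * expR (- k * t).
have dE (t : R) : is_derive t (1 : R) (fun s => expR (- k * s)) (expR (- k * t) * - k).
  apply: (@is_derive1_comp _ expR (fun s => - k * s)).
  have h := is_deriveZ (f := @id R) (x := t) (v := 1) (df := 1) (- k) _.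
  by have := h _; rewrite -[_ *: 1]/(_ * 1) mulr1; apply.
have dmP (t : R) : 0 <= t <= T -> is_derive t (1 : R) m (dm t).
  move=> tT; have h1 := dNP t tT; have h2 := dE t.
  have -> : dm t = N t *: (expR (- k * t) * - k) + expR (- k * t) *: dN t.
    by rewrite /dm -[_ *: _]/(_ * _) -[X in _ = _ + X]/(_ * _); ring.
  exact: is_deriveM.
have [c cI E] : exists2 c, c \in `]0, T[ & m T - m 0 = dm c * (T - 0).
  apply: MVT => // [t|].
    by rewrite in_itv/= => /andP[t0 tT]; apply: dmP; rewrite !ltW.
  apply: derivable_within_continuous => t; rewrite in_itv/= => tT.
  by have [] := dmP t tT.
have dm0 : dm c <= 0.
  apply: mulr_le0_ge0; last exact: expR_ge0.
  by rewrite subr_le0; apply: le; move: cI; rewrite in_itv.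
have mT : m T <= m 0 by rewrite -subr_le0 E subr0 pmulr_lle0.
rewrite -(@ler_pM2r _ (expR (- k * T))) ?expR_gt0//.
by rewrite -mulrA -expRD mulNr subrr expR0 mulr1; move: mT; rewrite /m mulr0 expR0 mulr1 mulNr.
Qed.

(** At the infimum of the bad times the bound holds by the step hypothesis, and by continuity it
    persists a little longer, which contradicts the infimum. This serves estimates that are
    available only as long as the bound itself holds. *)
Lemma bootstrap (N : R -> R) (c : R) :
  (forall t : R, 0 <= t <= 1 -> {for t, continuous N}) ->
  (forall T, 0 <= T <= 1 -> (forall t, 0 <= t < T -> N t < c) -> N T < c) ->
  forall t, 0 <= t <= 1 -> N t < c.
Proof.
move=> cN step t1 t1I; rewrite ltNge; apply/negP => ct1.
pose S := [set t : R | 0 <= t <= 1 /\ c <= N t].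
have S0 : S !=set0 by exists t1.
have lbS : lbound S 0 by move=> x [/andP[]].
have hS : has_inf S by split => //; exists 0.
pose T := inf S.
have T0 : 0 <= T by exact: lb_le_inf.
have TS x : S x -> T <= x by apply: ge_inf; exists 0.
have T1 : T <= 1 by have /andP[_] := t1I; apply: le_trans; exact: TS.
have TI : 0 <= T <= 1 by rewrite T0.
have NT : N T < c.
  apply: step => // t /andP[t0 tT]; rewrite ltNge; apply/negP => ct.
  have tS : S t by split=> //; rewrite t0 (le_trans (ltW tT)).
  by move: tT; rewrite ltNge TS.
have : \forall x \near T, N x < c by exact: (cvgr_lt (N T) (cN T TI) c NT).
move=> /nbhs_normP[d /= d0 dT].
have [y Sy yd] : exists2 y, S y & y < T + d by apply: inf_lt => //; rewrite ltrDl.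
have : N y < c.
  apply: dT; rewrite /ball_ /=; have := TS y Sy.
  by move=> Ty; rewrite distrC ger0_norm ?subr_ge0//; lra.
by case: Sy => _ h; rewrite ltNge h.
Qed.

(** The partial derivatives are continuous jointly in time and position, so that estimates become
    uniform on the graph of a trajectory, which is compact. *)
Definition solenoidal (X : R -> R * R -> R * R) : Prop :=
  exists a11 a12 a21 a22 : R * (R * R) -> R,
    [/\ [/\ continuous a11, continuous a12, continuous a21 & continuous a22],
        (forall (t : R) (z : R * R),
          [/\ is_derive z (1, 0) (fst \o X t) (a11 (t, z)),
              is_derive z (0, 1) (fst \o X t) (a12 (t, z)),
              is_derive z (1, 0) (snd \o X t) (a21 (t, z)) &
              is_derive z (0, 1) (snd \o X t) (a22 (t, z))]) &
        forall y, a11 y + a22 y = 0].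

(** For a Hamiltonian field this is [hamiltonian_flow] by conversion; the general form also covers
    the reversed flow. *)
Definition flow_of (X : R -> R * R -> R * R) (Phi : R -> R * R -> R * R) : Prop :=
  forall z, Phi 0 z = z /\
    forall t : R, 0 <= t <= 1 ->
      is_derive t (1 : R) (fun u => Phi u z) (X t (Phi t z)).

(** Compactness of the graph of the trajectory of [z] makes the first-order expansion of [X t] at
    [Phi t z] uniform in [t]. The coefficients form the matrix of the linearized equation. *)
Lemma flow_taylor X Phi z : solenoidal X -> flow_of X Phi ->
  exists (a11 a12 a21 a22 : R -> R) (L : R), [/\ 0 <= L,
    (forall t, 0 <= t <= 1 -> [/\ `|a11 t| <= L, `|a12 t| <= L, `|a21 t| <= L &
       `|a22 t| <= L]),
    (forall t, a11 t + a22 t = 0) &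
    forall e, 0 < e -> exists2 d, 0 < d &
      forall t w, 0 <= t <= 1 -> `|w| <= d ->
      `|(X t (Phi t z + w)).1 - (X t (Phi t z)).1 - (a11 t * w.1 + a12 t * w.2)| <=
        e * (`|w.1| + `|w.2|) /\
      `|(X t (Phi t z + w)).2 - (X t (Phi t z)).2 - (a21 t * w.1 + a22 t * w.2)| <=
        e * (`|w.1| + `|w.2|)].
Proof.
move=> [a11 [a12 [a21 [a22 [[c11 c12 c21 c22] da tr]]]]] fl.
have [_ dPhi] := fl z.
pose K := (fun t : R => (t, Phi t z)) @` `[0, 1].
have KI t : 0 <= t <= 1 -> K (t, Phi t z) by move=> tI; exists t; rewrite //= in_itv.
have cK : compact K.
  apply: continuous_compact; last exact: segment_compact.
  have cPhi : {within `[0, 1], continuous (fun t : R => Phi t z)}.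
    apply: derivable_within_continuous => t; rewrite in_itv/= => tI.
    by have [] := dPhi t tI.
  move=> t; apply: (@cvg_pair _ _ _ _ (nbhs (t : R)) (nbhs (Phi t z))).
    exact: (@continuous_subspaceT _ _ _ (@id R) (fun x => @cvg_id _ _) t).
  exact: cPhi.
have [C1 C10 h1] := compact_norm_bound c11 cK.
have [C2 C20 h2] := compact_norm_bound c12 cK.
have [C3 C30 h3] := compact_norm_bound c21 cK.
have [C4 C40 h4] := compact_norm_bound c22 cK.
exists (fun t => a11 (t, Phi t z)), (fun t => a12 (t, Phi t z)),
  (fun t => a21 (t, Phi t z)), (fun t => a22 (t, Phi t z)), (C1 + C2 + C3 + C4).
split=> //; first by rewrite !addr_ge0.
  move=> t /KI Kt; move: (h1 _ Kt) (h2 _ Kt) (h3 _ Kt) (h4 _ Kt) => *.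
  by split; lra.
move=> e e0.
have [d1 d10 H1] := near_shift_bound c11 cK e0.
have [d2 d20 H2] := near_shift_bound c12 cK e0.
have [d3 d30 H3] := near_shift_bound c21 cK e0.
have [d4 d40 H4] := near_shift_bound c22 cK e0.
exists (Num.min (Num.min d1 d2) (Num.min d3 d4)).
  by rewrite !lt_min d10 d20 d30.
move=> t w tI; rewrite !le_min => /andP[/andP[w1 w2] /andP[w3 w4]].
have sh (p : R * (R * R) -> R) (d : R) u :
   (forall y u, K y -> `|u| <= d -> `|p (y + u) - p y| <= e) ->
   `|u| <= `|w| -> `|w| <= d ->
   `|p (t, Phi t z + u) - p (t, Phi t z)| <= e.
  move=> H uw wd; have := H (t, Phi t z) (0, u) (KI t tI).
  have -> : (t, Phi t z) + (0, u) = (t, Phi t z + u) by apply: pair_ext; rewrite /= ?addr0.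
  apply; rewrite prod_normE /= normr0 ge_max (le_trans uw wd) andbT.
  by rewrite (le_trans _ wd).
split.
- apply: (@taylor1 _ (fst \o X t) (fun y => a11 (t, y)) (fun y => a12 (t, y)) (Phi t z) w).
  + by move=> x; have [] := da t x.
  + by move=> x; have [] := da t x.
  + by move=> u uw; apply: (sh _ d1).
  + by move=> u uw; apply: (sh _ d2).
- apply: (@taylor1 _ (snd \o X t) (fun y => a21 (t, y)) (fun y => a22 (t, y)) (Phi t z) w).
  + by move=> x; have [] := da t x.
  + by move=> x; have [] := da t x.
  + by move=> u uw; apply: (sh _ d3).
  + by move=> u uw; apply: (sh _ d4).
Qed.

Lemma flow_difference X Phi z z' (t : R) : flow_of X Phi -> 0 <= t <= 1 ->
  is_derive t (1 : R) (fun u => (Phi u z' - Phi u z).1)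
    ((X t (Phi t z')).1 - (X t (Phi t z)).1) /\
  is_derive t (1 : R) (fun u => (Phi u z' - Phi u z).2)
    ((X t (Phi t z')).2 - (X t (Phi t z)).2).
Proof.
move=> fl tI; have [_ /(_ t tI) h] := fl z; have [_ /(_ t tI) h'] := fl z'.
have h1 := is_derive_fst h; have h1' := is_derive_fst h'.
have h2 := is_derive_snd h; have h2' := is_derive_snd h'.
split; first exact: (is_deriveB h1' h1).
exact: (is_deriveB h2' h2).
Qed.

(** Gronwall's inequality for the squared Euclidean distance of two trajectories. The linear bound
    on the field holds only within distance [d] of the first trajectory, and [bootstrap] keeps the
    second one there. *)
Lemma flow_lipschitz X Phi z : solenoidal X -> flow_of X Phi ->
  exists C d : R, [/\ 0 < C, 0 < d & forall w, `|w| < d ->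
    forall t, 0 <= t <= 1 -> `|Phi t (z + w) - Phi t z| <= C * `|w|].
Proof.
move=> sX fl.
have [a11 [a12 [a21 [a22 [L [L0 aL tr /(_ 1 ltr01)[d d0 H]]]]]]] := flow_taylor z sX fl.
(* Both [dx] and [dy] are bounded by [(L + 1) * (|x| + |y|)], hence [dN <= 4 * (L + 1) * N]. In the
   sup norm [N 0 <= 2 * |w| ^+ 2], whence the factor 2; since [C >= 1], the resulting [C * |w| ^+ 2]
   is at most [(C * |w|) ^+ 2]. *)
pose k := 4 * (L + 1); pose C := 2 * expR k.
have k0 : 0 <= k by rewrite /k; lra.
have C0 : 0 < C by rewrite mulr_gt0// expR_gt0.
exists C, (d / C); split=> //; first by rewrite divr_gt0.
move=> w wd.
pose x (t : R) := (Phi t (z + w) - Phi t z).1.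
pose y (t : R) := (Phi t (z + w) - Phi t z).2.
pose N (t : R) := x t ^+ 2 + y t ^+ 2.
pose dx (t : R) := (X t (Phi t (z + w))).1 - (X t (Phi t z)).1.
pose dy (t : R) := (X t (Phi t (z + w))).2 - (X t (Phi t z)).2.
pose dN (t : R) := 2 * (x t * dx t + y t * dy t).
have normE (t : R) : `|Phi t (z + w) - Phi t z| = Num.max `|x t| `|y t| by rewrite prod_normE.
have dNP (t : R) : 0 <= t <= 1 -> is_derive t (1 : R) N (dN t).
  move=> tI; have [h1 h2] := flow_difference z (z + w) fl tI.
  have -> : dN t = (x t *: dx t + x t *: dx t) + (y t *: dy t + y t *: dy t).
    rewrite /dN -[x t *: _]/(_ * _) -[y t *: _]/(_ * _); ring.
  have -> : N = (x * x) + (y * y) by apply/funext => s; rewrite /N /= !expr2.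
  by apply: is_deriveD; apply: is_deriveM.
have cN (t : R) : 0 <= t <= 1 -> {for t, continuous N}.
  move=> tI; apply: differentiable_continuous; apply/derivable1_diffP.
  by have [] := dNP t tI.
have small (t : R) : N t < d ^+ 2 -> `|Phi t (z + w) - Phi t z| <= d.
  move=> Nt; rewrite normE ge_max -!(@ler_sqr _ _ d) ?nnegrE ?(ltW d0)//.
  rewrite !real_normK ?num_real//; have := sqr_ge0 (x t); have := sqr_ge0 (y t).
  by move: Nt; rewrite /N => *; apply/andP; split; lra.
have dNk (t : R) : 0 <= t <= 1 -> N t < d ^+ 2 -> dN t <= k * N t.
  move=> tI /small sm; have [] := H t _ tI sm; rewrite -/(x t) -/(y t).
  have -> : Phi t z + (Phi t (z + w) - Phi t z) = Phi t (z + w) by rewrite addrC subrK.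
  rewrite -/(dx t) -/(dy t) mul1r => h1 h2.
  have [b1 b2 b3 b4] := aL t tI.
  have g (a b u : R) : `|a| <= L -> `|b| <= L ->
      `|u - (a * x t + b * y t)| <= `|x t| + `|y t| ->
      `|u| <= (L + 1) * (`|x t| + `|y t|).
    move=> aL1 bL1 hu; have -> : u = (u - (a * x t + b * y t)) + (a * x t + b * y t) by ring.
    apply: le_trans (ler_normD _ _) _; rewrite mulrDl mul1r addrC; apply: lerD => //.
    apply: le_trans (ler_normD _ _) _; rewrite !normrM mulrDr.
    by apply: lerD; apply: ler_wpM2r.
  have {}h1 := g _ _ _ b1 b2 h1; have {}h2 := g _ _ _ b3 b4 h2.
  have m1 : x t * dx t <= `|x t| * ((L + 1) * (`|x t| + `|y t|)).
    by apply: le_trans (ler_norm _) _; rewrite normrM ler_wpM2l.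
  have m2 : y t * dy t <= `|y t| * ((L + 1) * (`|x t| + `|y t|)).
    by apply: le_trans (ler_norm _) _; rewrite normrM ler_wpM2l.
  rewrite /dN /k /N -(real_normK (num_real (x t))) -(real_normK (num_real (y t))).
  move: m1 m2; set p := `|x t|; set q := `|y t| => m1 m2.
  have sq : 0 <= (L + 1) * (p - q) ^+ 2 by rewrite mulr_ge0 ?sqr_ge0//; lra.
  by move: sq m1 m2; rewrite !expr2; nra.
have N0 : N 0 <= 2 * `|w| ^+ 2.
  have [E1 _] := fl z; have [E2 _] := fl (z + w).
  rewrite /N /x /y E1 E2 addrAC subrr add0r mulr2n mulrDl !mul1r.
  rewrite -(real_normK (num_real w.1)) -(real_normK (num_real w.2)).
  by apply: lerD; rewrite ler_sqr ?nnegrE// prod_normE le_max lexx ?orbT.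
have bound T : 0 <= T <= 1 -> (forall t, 0 <= t < T -> N t < d ^+ 2) ->
    N T <= C * `|w| ^+ 2.
  move=> /andP[T0 T1] h.
  have := @gronwall N dN k T T0 _ _; have e1 : expR (k * T) <= expR k.
    by rewrite ler_expR ler_piMr.
  move=> G; apply: (@le_trans _ _ (N 0 * expR (k * T))).
    apply: G => t /andP[t0 tT].
      by apply: dNP; rewrite t0 (le_trans tT).
    by apply: dNk; [rewrite !ltW// (lt_le_trans tT)|apply: h; rewrite ltW].
  apply: (@le_trans _ _ (2 * `|w| ^+ 2 * expR k)).
    by apply: ler_pM => //; rewrite ?expR_ge0// /N addr_ge0 ?sqr_ge0.
  by rewrite /C mulrAC.
have C1 : 1 <= C by rewrite /C; have : 1 <= expR k by [rewrite -expR0 ler_expR]; lra.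
have CC : C * `|w| ^+ 2 <= (C * `|w|) ^+ 2.
  by rewrite exprMn ler_wpM2r ?sqr_ge0// expr2 ler_peMl// ltW.
have Cwd : C * `|w| < d by rewrite mulrC -ltr_pdivlMr.
have Cw0 : 0 <= C * `|w| by rewrite mulr_ge0// ltW.
have Nd : forall t, 0 <= t <= 1 -> N t < d ^+ 2.
  apply: bootstrap => // T TI h; apply: le_lt_trans (bound T TI h) _.
  by apply: le_lt_trans CC _; rewrite ltr_sqr ?nnegrE ?(ltW d0).
move=> t tI.
have {}bound : N t <= (C * `|w|) ^+ 2.
  apply: le_trans CC; apply: bound => // s /andP[s0 st]; apply: Nd.
  by rewrite s0 (le_trans (ltW st))//; case/andP: tI.
rewrite normE ge_max -!(@ler_sqr _ _ (C * `|w|)) ?nnegrE//.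
rewrite !real_normK ?num_real//; have := sqr_ge0 (x t); have := sqr_ge0 (y t).
by move: bound; rewrite /N => *; apply/andP; split; lra.
Qed.

Definition cross (u v : R * R) : R := u.1 * v.2 - u.2 * v.1.

(* The derivative of [cross] along two neighbouring trajectories is the
   divergence, which is zero, times [cross], plus a remainder that is small
   with respect to h^2. *)
Lemma flow_area_element X Phi (z : R * R) : solenoidal X -> flow_of X Phi ->
  exists2 C : R, 0 <= C & forall e, 0 < e -> exists2 d, 0 < d &
    forall h : R, `|h| < d ->
    `|cross (Phi 1 (z + h *: (1, 0)) - Phi 1 z) (Phi 1 (z + h *: (0, 1)) - Phi 1 z)
      - h ^+ 2| <= C * e * h ^+ 2.
Proof.
move=> sX fl.
have [a11 [a12 [a21 [a22 [L [L0 aL tr H]]]]]] := flow_taylor z sX fl.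
have [C [d [C0 d0 lip]]] := flow_lipschitz z sX fl.
(* The derivative of [D] reduces to four products of a remainder, at most [2 * e * m], with a
   displacement, at most [m], where [m = C * |h|]. *)
exists (8 * C ^+ 2); first by rewrite mulr_ge0 ?sqr_ge0.
move=> e e0; have [d' d'0 {}H] := H e e0.
exists (Num.min d (d' / C)); first by rewrite lt_min d0 divr_gt0.
move=> h; rewrite lt_min => /andP[hd hd'].
have hC : C * `|h| <= d' by rewrite mulrC -ler_pdivlMr// ltW.
have n10 : `|h *: ((1, 0) : R * R)| = `|h|.
  by rewrite normrZ prod_normE /= normr1 normr0 (max_idPl _) ?ler01// mulr1.
have n01 : `|h *: ((0, 1) : R * R)| = `|h|.
  by rewrite normrZ prod_normE /= normr1 normr0 (max_idPr _) ?ler01// mulr1.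
pose w1 (t : R) := Phi t (z + h *: (1, 0)) - Phi t z.
pose w2 (t : R) := Phi t (z + h *: (0, 1)) - Phi t z.
have n1 (t : R) : 0 <= t <= 1 -> `|w1 t| <= C * `|h|.
  by move=> tI; rewrite -n10; apply: lip => //; rewrite n10.
have n2 (t : R) : 0 <= t <= 1 -> `|w2 t| <= C * `|h|.
  by move=> tI; rewrite -n01; apply: lip => //; rewrite n01.
pose dw1 (t : R) := X t (Phi t (z + h *: (1, 0))) - X t (Phi t z).
pose dw2 (t : R) := X t (Phi t (z + h *: (0, 1))) - X t (Phi t z).
pose D (t : R) := (w1 t).1 * (w2 t).2 - (w1 t).2 * (w2 t).1.
pose dD (t : R) := (dw1 t).1 * (w2 t).2 + (w1 t).1 * (dw2 t).2 -
  ((dw1 t).2 * (w2 t).1 + (w1 t).2 * (dw2 t).1).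
have dDP (t : R) : 0 <= t <= 1 -> is_derive t (1 : R) D (dD t).
  move=> tI; have [h1 h2] := flow_difference z (z + h *: (1, 0)) fl tI.
  have [h3 h4] := flow_difference z (z + h *: (0, 1)) fl tI.
  have -> : dD t = ((w1 t).1 *: (dw2 t).2 + (w2 t).2 *: (dw1 t).1) -
      ((w1 t).2 *: (dw2 t).1 + (w2 t).1 *: (dw1 t).2).
    by rewrite /dD /GRing.scale /=; ring.
  by apply: is_deriveB; apply: is_deriveM.
have bound (t : R) : 0 <= t <= 1 -> `|dD t| <= 8 * C ^+ 2 * e * h ^+ 2.
  move=> tI; have m1 := n1 t tI; have m2 := n2 t tI.
  have E1 : Phi t z + w1 t = Phi t (z + h *: (1, 0)) by rewrite /w1 addrC subrK.
  have E2 : Phi t z + w2 t = Phi t (z + h *: (0, 1)) by rewrite /w2 addrC subrK.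
  have := H t (w1 t) tI (le_trans m1 hC); rewrite E1 => -[b11 b12].
  have := H t (w2 t) tI (le_trans m2 hC); rewrite E2 => -[b21 b22].
  pose r11 := (dw1 t).1 - (a11 t * (w1 t).1 + a12 t * (w1 t).2).
  pose r12 := (dw1 t).2 - (a21 t * (w1 t).1 + a22 t * (w1 t).2).
  pose r21 := (dw2 t).1 - (a11 t * (w2 t).1 + a12 t * (w2 t).2).
  pose r22 := (dw2 t).2 - (a21 t * (w2 t).1 + a22 t * (w2 t).2).
  have -> : dD t = r11 * (w2 t).2 + (w1 t).1 * r22 - (r12 * (w2 t).1 +
      (w1 t).2 * r21).
    have E : a22 t = - a11 t by apply/eqP; rewrite -addr_eq0 addrC tr.
    by rewrite /r11 /r22 /r12 /r21 /dD E; ring.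
  move: m1 m2; rewrite !prod_normE !ge_max => /andP[p1 p2] /andP[q1 q2].
  move: hC p1 p2 q1 q2; set m := C * `|h| => hC p1 p2 q1 q2.
  have {}b11 : `|r11| <= 2 * e * m.
    by apply: le_trans b11 _; rewrite (mulrC 2) -mulrA ler_pM2l//; lra.
  have {}b12 : `|r12| <= 2 * e * m.
    by apply: le_trans b12 _; rewrite (mulrC 2) -mulrA ler_pM2l//; lra.
  have {}b21 : `|r21| <= 2 * e * m.
    by apply: le_trans b21 _; rewrite (mulrC 2) -mulrA ler_pM2l//; lra.
  have {}b22 : `|r22| <= 2 * e * m.
    by apply: le_trans b22 _; rewrite (mulrC 2) -mulrA ler_pM2l//; lra.
  have -> : 8 * C ^+ 2 * e * h ^+ 2 = (2 * e * m * m + m * (2 * e * m)) +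
      (2 * e * m * m + m * (2 * e * m)).
    rewrite -(real_normK (num_real h)) /m; ring.
  apply: le_trans (ler_normB _ _) _; apply: lerD;
    by apply: le_trans (ler_normD _ _) _; rewrite !normrM; apply: lerD; apply: ler_pM.
have [c cI E] : exists2 c : R, c \in `]0, 1[ & D 1 - D 0 = dD c * (1 - 0).
  apply: MVT => // [t|].
    by rewrite in_itv/= => /andP[t0 t1]; apply: dDP; rewrite !ltW.
  apply: derivable_within_continuous => t; rewrite in_itv/= => tI.
  by have [] := dDP t tI.
have D0 : D 0 = h ^+ 2.
  rewrite /D /w1 /w2.
  have [-> _] := fl z; have [-> _] := fl (z + h *: (1, 0)).
  have [-> _] := fl (z + h *: (0, 1)).
  have e' (w : R * R) : z + w - z = w by rewrite addrAC subrr add0r.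
  rewrite !e' /= -[h *: 1]/(h * 1) -[h *: 0]/(h * 0).
  by ring.
rewrite -[cross _ _]/(D 1) -D0 E subr0 mulr1 D0.
by apply: bound; move: cI; rewrite in_itv/= => /andP[c0 c1]; rewrite !ltW.
Qed.

Lemma is_derive_quotient (V : normedModType R) (f : V -> R) (z v : V) (d : R) :
  is_derive z v f d -> h^-1 * (f (z + h *: v) - f z) @[h --> 0^'] --> d.
Proof.
move=> [df <-]; rewrite (_ : (fun h : R => _) =
  (fun h : R => h^-1 *: ((f \o shift z) (h *: v) - f z))); first exact: df.
by apply/funext => h; rewrite /= [z + _]addrC.
Qed.

(** After division by [h ^+ 2] the cross product in [flow_area_element] tends to the Jacobian
    determinant, so the latter differs from 1 by at most any given [e]. *)
Lemma flow_det X Phi (z : R * R) (p q r s : R) : solenoidal X -> flow_of X Phi ->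
  is_derive z (1, 0) (fst \o Phi 1) p -> is_derive z (0, 1) (fst \o Phi 1) q ->
  is_derive z (1, 0) (snd \o Phi 1) r -> is_derive z (0, 1) (snd \o Phi 1) s ->
  p * s - q * r = 1.
Proof.
move=> sX fl [cp Ep] [cq Eq] [cr Er] [cs Es].
have [C C0 H] := flow_area_element z sX fl.
apply/eqP; rewrite -subr_eq0 -normr_le0; apply/ler_addgt0Pr => e e0.
have C1 : 0 < C + 1 by lra.
have [d d0 {}H] := H (e / (C + 1)) (divr_gt0 e0 C1).
pose u (h : R) := Phi 1 (z + h *: (1, 0)) - Phi 1 z.
pose v (h : R) := Phi 1 (z + h *: (0, 1)) - Phi 1 z.
have cv : (fun h : R => h^-1 * (u h).1 * (h^-1 * (v h).2) -
    h^-1 * (v h).1 * (h^-1 * (u h).2)) h @[h --> 0^'] --> p * s - q * r.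
  rewrite -Ep -Eq -Er -Es; apply: cvgB; apply: cvgM.
  - exact: (is_derive_quotient (DeriveDef cp erefl)).
  - exact: (is_derive_quotient (DeriveDef cs erefl)).
  - exact: (is_derive_quotient (DeriveDef cq erefl)).
  - exact: (is_derive_quotient (DeriveDef cr erefl)).
have cv1 : (fun h : R => `|h^-1 * (u h).1 * (h^-1 * (v h).2) -
    h^-1 * (v h).1 * (h^-1 * (u h).2) - 1|) h @[h --> 0^'] --> `|p * s - q * r - 1|.
  by apply: cvg_norm; apply: cvgB => //; exact: cvg_cst.
apply: (cvgr_to_le cv1); near=> h.
have h0 : h != 0 by near: h; exact: nbhs_dnbhs_neq.
have hd : `|h| < d by near: h; exact: dnbhs0_lt.
rewrite add0r; have := H h hd; rewrite -/(u h) -/(v h) => B.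
have h2 : 0 < h ^+ 2 by rewrite exprn_even_gt0.
rewrite -(ler_pM2r h2) -{1}(ger0_norm (ltW h2)) -normrM.
rewrite [X in `|X|](_ : _ = (u h).1 * (v h).2 - (u h).2 * (v h).1 - h ^+ 2).
  apply: le_trans B _; rewrite ler_pM2r// mulrA ler_pdivrMr// mulrC.
  by rewrite ler_pM2l//; lra.
by rewrite /= ; field.
Unshelve. all: by end_near.
Qed.

End Flow.

(** * Hamiltonian diffeomorphisms preserve area *)

Section HamiltonianArea.
Context {R : realType}.

Lemma class_C_is_derive (V W : normedModType R) (f : V -> W) n x v :
  class_C n.+1 f -> is_derive x v f ('D_v f x).
Proof. by move=> [_ /(_ v)[df _]]; apply: DeriveDef. Qed.

Lemma class_C_derive (V W : normedModType R) (f : V -> W) n v :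
  class_C n.+1 f -> class_C n (fun x => 'D_v f x).
Proof. by move=> [_ /(_ v)[]]. Qed.

Lemma class_C_continuous (V W : normedModType R) (f : V -> W) n :
  class_C n f -> continuous f.
Proof. by case: n => [|n] []. Qed.

Lemma is_derive_slice (V1 V2 W : normedModType R) (f : V1 * V2 -> W) t z v d :
  is_derive (t, z) (0, v) f d -> is_derive z v (fun w => f (t, w)) d.
Proof.
have E : (fun h : R => h^-1 *: (((fun w => f (t, w)) \o shift z) (h *: v) - f (t, z))) =
    (fun h : R => h^-1 *: ((f \o shift (t, z)) (h *: (0, v)) - f (t, z))).
  apply/funext => h; congr (_ *: (f _ - _)).
  by apply: pair_ext => //=; rewrite scaler0 add0r.
by move=> [df <-]; apply: DeriveDef; [rewrite /derivable E|rewrite /derive E].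
Qed.

(** The divergence is the difference of the two mixed second derivatives of [H] in the space
    directions. *)
Lemma hamiltonian_solenoidal (H : R * (R * R) -> R) : smooth H ->
  solenoidal (fun t => hamiltonian_vector_field (fun w => H (t, w))).
Proof.
move=> sH; pose e1 : R * (R * R) := (0, (1, 0)); pose e2 : R * (R * R) := (0, (0, 1)).
have H2 := sH 2%N.
have D1 v y := class_C_is_derive y v H2.
have C1 v := class_C_derive v H2.
have D2 v w y := class_C_is_derive y w (C1 v).
have C2 v w := class_C_continuous (class_C_derive w (C1 v)).
have slice t z v : 'D_v (fun w => H (t, w)) z = 'D_(0, v) H (t, z).
  by have h := is_derive_slice (D1 (0, v) (t, z)); exact: derive_val.
exists (fun y => 'D_e1 ('D_e2 H) y), (fun y => 'D_e2 ('D_e2 H) y),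
  (fun y => - 'D_e1 ('D_e1 H) y), (fun y => - 'D_e2 ('D_e1 H) y).
split.
- split; try exact: C2.
  + by move=> y; apply: cvgN; exact: C2.
  + by move=> y; apply: cvgN; exact: C2.
- move=> t z.
  have -> : fst \o hamiltonian_vector_field (fun w => H (t, w)) =
      (fun w => 'D_e2 H (t, w)) by apply/funext => w; exact: slice.
  have -> : snd \o hamiltonian_vector_field (fun w => H (t, w)) =
      - (fun w => 'D_e1 H (t, w)) by apply/funext => w; rewrite /= slice.
  split.
  + exact: is_derive_slice.
  + exact: is_derive_slice.
  + by apply: is_deriveN; exact: is_derive_slice.
  + by apply: is_deriveN; exact: is_derive_slice.
- move=> y; apply/eqP; rewrite subr_eq0; apply/eqP.
  have S := schwarz_derive (D1 e2) (D1 e1) (D2 e2 e1) (D2 e1 e2) (C2 e2 e1) (C2 e1 e2).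
  exact: (S y).
Qed.

Lemma flow_area_le X Phi (phi g : R * R -> R * R) (B : set (R * R)) :
  solenoidal X -> flow_of X Phi -> phi = Phi 1 -> class_C 1 phi -> continuous g ->
  cancel phi g -> cancel g phi ->
  open B -> bounded_set B -> (area B < +oo)%E -> (area (phi @` B) <= area B)%E.
Proof.
move=> sX fl -> C1 cg fK gK oB bB fB.
have D v (z : R * R) := class_C_is_derive z v C1.
have cD v := class_C_continuous (class_C_derive v C1).
have cfst v : continuous (fun z => ('D_v (Phi 1) z).1).
  by move=> z; apply: (cvg_comp _ _ (cD v z)); exact: cvg_fst.
have csnd v : continuous (fun z => ('D_v (Phi 1) z).2).
  by move=> z; apply: (cvg_comp _ _ (cD v z)); exact: cvg_snd.
have D1 v z := is_derive_fst (D v z); have D2 v z := is_derive_snd (D v z).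
apply: (@area_image_le _ (Phi 1) g (fun z => ('D_(1, 0) (Phi 1) z).1)
  (fun z => ('D_(0, 1) (Phi 1) z).1) (fun z => ('D_(1, 0) (Phi 1) z).2)
  (fun z => ('D_(0, 1) (Phi 1) z).2)) => //.
by move=> z; apply: (flow_det sX fl).
Qed.

Lemma reverse_solenoidal (X : R -> R * R -> R * R) : solenoidal X ->
  solenoidal (fun t z => - X (1 - t) z).
Proof.
move=> [a11 [a12 [a21 [a22 [[c11 c12 c21 c22] da tr]]]]].
have c (a : R * (R * R) -> R) : continuous a ->
    continuous (fun y : R * (R * R) => - a (1 - y.1, y.2)).
  move=> ca y; apply: cvgN.
  have h : (fun x : R * (R * R) => (1 - x.1, x.2)) x @[x --> y] --> (1 - y.1, y.2).
    apply: (@cvg_pair _ _ _ _ (nbhs (1 - y.1)) (nbhs y.2)).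
      by apply: cvgB; [exact: cvg_cst|exact: cvg_fst].
    exact: cvg_snd.
  exact: (cvg_comp _ _ h (ca _)).
exists (fun y : R * (R * R) => - a11 (1 - y.1, y.2)),
  (fun y : R * (R * R) => - a12 (1 - y.1, y.2)),
  (fun y : R * (R * R) => - a21 (1 - y.1, y.2)),
  (fun y : R * (R * R) => - a22 (1 - y.1, y.2)).
split.
- by split; exact: c.
- move=> t z; have [d11 d12 d21 d22] := da (1 - t) z.
  by split; apply: is_deriveN.
- by move=> y; rewrite -opprD tr oppr0.
Qed.

Lemma is_derive_opp_direction (W : normedModType R) (f : R -> W) (x : R) d :
  is_derive x (1 : R) f d -> is_derive x (-1 : R) f (- d).
Proof.
move=> [/derivable1_diffP df <-]; apply: DeriveDef; first exact: diff_derivable.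
by rewrite !deriveE// linearN.
Qed.

(** Trajectories are run backwards from [Phi 1 (g w) = w]; as [Phi 0] is the identity, the time-one
    map of the reversed flow is [g]. *)
Lemma reverse_flow (X Phi : R -> R * R -> R * R) g :
  flow_of X Phi -> cancel g (Phi 1) ->
  flow_of (fun t z => - X (1 - t) z) (fun t w => Phi (1 - t) (g w)).
Proof.
move=> fl gK w; split; first by rewrite subr0 gK.
move=> t /andP[t0 t1]; have [_ h] := fl (g w).
have E (s : R) : 1 + s *: (-1) = 1 - s by rewrite -[s *: _]/(s * _) mulrN1.
have {}h : is_derive ((1 : R) + t *: (-1 : R)) (-1 : R) (fun u => Phi u (g w))
    (- X (1 - t) (Phi (1 - t) (g w))).
  rewrite E; apply: is_derive_opp_direction.
  by apply: h; rewrite subr_ge0 t1 gerBl.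
have := is_derive_along h.
by under eq_fun do rewrite E.
Qed.

(** [flow_area_le] is applied to [phi] on [B] and to its inverse on the image of [B]; the second use
    is where the image has to be bounded. *)
Theorem hamiltonian_area (phi : R * R -> R * R) (B : set (R * R)) :
  hamiltonian_diffeomorphism phi -> open B -> bounded_set B ->
  (area B < +oo)%E -> bounded_set (phi @` B) -> area (phi @` B) = area B.
Proof.
move=> [[sphi [g [sg fK gK]]] [H [Phi [sH fl Ephi]]]] oB bB fB bpB.
have cphi := class_C_continuous (sphi 0%N).
have cg := class_C_continuous (sg 0%N).
have sX := hamiltonian_solenoidal sH.
have le1 : (area (phi @` B) <= area B)%E.
  by apply: (flow_area_le sX fl Ephi (sphi 1%N) cg).
apply/eqP; rewrite eq_le le1 /=.
have gphi : g @` (phi @` B) = B.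
  apply/seteqP; split=> z; first by move=> [_ [w Bw <-] <-]; rewrite fK.
  by move=> Bz; exists (phi z); rewrite ?fK//; exists z.
rewrite -{1}gphi.
have gK' : cancel g (Phi 1) by rewrite -Ephi.
have oV : open (phi @` B).
  by rewrite (image_can2 _ fK gK); apply: open_comp => // z _; exact: cg.
apply: (flow_area_le (reverse_solenoidal sX) (reverse_flow fl gK') _ (sg 1%N) cphi) => //.
  by apply/funext => w; rewrite subrr; have [] := fl (g w).
exact: le_lt_trans le1 fB.
Qed.

End HamiltonianArea.

(** * Disjoint regions in the disk *)

Section Regions.
Context {R : realType}.
Local Notation P := (measurableTypeR R * measurableTypeR R)%type.
Local Notation areaM := (@lebesgue_measure R \x @lebesgue_measure R)%E.
Implicit Types U V C D : set (R * R).

Lemma area_open_gt0 U : open U -> U !=set0 -> (0 < area U)%E.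
Proof.
move=> oU [z Uz]; have /nbhs_ballP[e /= e0 eU] : nbhs z U by exact: open_nbhs_nbhs.
pose B : set P := `[z.1 - e / 2, z.1 + e / 2] `*` `[z.2 - e / 2, z.2 + e / 2].
apply: (@lt_le_trans _ _ (area B)).
  by rewrite area_box; [rewrite lte_fin mulr_gt0//; lra|lra|lra].
apply: (@le_measure _ _ _ areaM); rewrite ?inE.
- exact: measurableX.
- exact: measurable_open_plane.
- move=> w [/= w1 w2]; apply: eU; move: w1 w2; rewrite !in_itv/= => /andP[? ?] /andP[? ?].
  by split; rewrite /ball /= ltr_norml; apply/andP; split; lra.
Qed.

Lemma area_setU (A B : set P) : measurable A -> measurable B -> A `&` B = set0 ->
  area (A `|` B) = (area A + area B)%E.
Proof. exact: (measureU areaM). Qed.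

(* U is an open domain of area s, and C stands for its boundary curve; that the
   boundary of U be all of C is not required. *)
Definition region (b s : R) U C : Prop :=
  [/\ open U, connected U, bounded_set U & area U = s%:E] /\
  [/\ connected C, U `&` C = set0, closure U `<=` U `|` C & C `<=` std_disk b].

Lemma region_nonempty b s U C : 0 < s -> region b s U C -> U !=set0.
Proof.
move=> s0 [[_ _ _ aU] _]; apply/set0P/eqP => U0.
move: aU; rewrite U0 /area measure0 => -[s00].
by move: s0; rewrite -s00 ltxx.
Qed.

(** [U] without [closure V] is open, and it is nonempty since otherwise [U] would be closed. As the
    boundary of [V] may have positive area, the areas added are those of [V] and of this remainder,
    and their sum is at most the area of [U]. *)
Lemma region_not_nested b s U C V D : 0 < s ->
  region b s U C -> region b s V D -> ~ (closure V `<=` U).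
Proof.
move=> s0 rU rV VU; have U0 := region_nonempty s0 rU.
have [[oU _ bU aU] _] := rU; have [[oV _ _ aV] _] := rV.
pose W := U `\` closure V.
have oW : open W.
  by rewrite /W setDE; apply: openI => //; apply: closed_openC; exact: closed_closure.
have W0 : W !=set0.
  apply/set0P/eqP => We; apply: (bounded_open_not_closed oU bU U0).
  have UV : U `<=` closure V by apply/subsets_disjoint; rewrite -setDE.
  apply: (subset_trans (closureS UV)).
  by rewrite -(closure_id _).1//; exact: closed_closure.
have mV := measurable_open_plane oV; have mW := measurable_open_plane oW.
have VW : V `&` W = set0.
  by apply/seteqP; split=> // x [Vx [_]]; apply; exact: subset_closure.
have le : (area (V `|` W) <= area U)%E.
  apply: (@le_measure _ _ _ areaM); rewrite ?inE.
  - exact: measurableU.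
  - exact: measurable_open_plane.
  - by move=> x [Vx|[]//]; apply: VU; exact: subset_closure.
have aW := area_open_gt0 oW W0.
move: le; rewrite area_setU// aU aV -{2}[s%:E]adde0 leeD2lE//.
by rewrite leNgt aW.
Qed.

Lemma region_disjoint b s U C V D : 0 < s ->
  region b s U C -> region b s V D -> C `&` D = set0 -> U `&` V = set0.
Proof.
move=> s0 rU rV CD.
have [[oU cU bU aU] [cC UC clU _]] := rU; have [[oV cV bV aV] [cD VD clV _]] := rV.
have ncl : ~ (closure (U `|` V) `<=` U `|` V).
  apply: bounded_open_not_closed; first exact: openU.
    have [M [Mr hM]] := bU; have [M' [Mr' hM']] := bV.
    exists (Num.max M M'); split; first exact: num_real.
    by move=> x; rewrite gt_max => /andP[h1 h2] z [/hM|/hM']; apply.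
  by have [x Ux] := region_nonempty s0 rU; exists x; left.
have [//|VU|UV] := disjoint_or_nested oU cU cC UC clU oV cV cD VD clV CD ncl.
- by have := region_not_nested s0 rU rV.
- by have := region_not_nested s0 rV rU.
Qed.

Lemma regions_area_lt (b s : R) (n : nat) (U C : 'I_n -> set (R * R)) :
  0 < b -> 0 < s -> (forall i, region b s (U i) (C i)) ->
  (forall i j, i != j -> C i `&` C j = set0) -> n%:R * s < b.
Proof.
move=> b0 s0 rU CC.
(* The positive area of [W] makes the final inequality strict. [W] is nonempty since otherwise the
   disk would be a finite union of closed sets, hence closed. *)
pose W := std_disk b `\` \bigcup_i closure (U i).
have clC : closed (\bigcup_i closure (U i)).
  by apply: closed_bigcup => [|i _]; [exact: finite_finset|exact: closed_closure].
have oW : open W.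
  by rewrite /W setDE; apply: openI; [exact: open_std_disk|exact: closed_openC].
have UD i : U i `<=` std_disk b.
  by have [[oU _ bU _] [_ _ clU CD]] := rU i; exact: region_sub_disk clU CD.
have clUD i : closure (U i) `<=` std_disk b.
  have [_ [_ _ clU CD]] := rU i.
  by move=> x /clU[/UD|/CD].
have W0 : W !=set0.
  apply/set0P/eqP => We.
  apply: (@bounded_open_not_closed R (std_disk b)).
  - exact: open_std_disk.
  - exact: bounded_std_disk.
  - by exists 0; rewrite /std_disk /sqnorm /= expr0n /= addr0 mulr0.
  have E : std_disk b = \bigcup_i closure (U i).
    apply/seteqP; split; first by apply/subsets_disjoint; rewrite -setDE.
    by move=> x [i _]; exact: clUD.
  by rewrite {1}E -(closure_id _).1// -E.
have mU i : measurable (U i : set P).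
  by apply: measurable_open_plane; have [[]] := rU i.
have mW := measurable_open_plane oW.
have mUU : measurable (\bigcup_i U i : set P).
  by apply: measurable_open_plane; apply: bigcup_open => i _; have [[]] := rU i.
have tU : trivIset [set: 'I_n] U.
  apply/trivIsetP => i j _ _ ij.
  exact: (region_disjoint s0 (rU i) (rU j) (CC i j ij)).
have aU : area (\bigcup_i U i) = (n%:R * s)%:E.
  rewrite (_ : \bigcup_i U i = \big[setU/set0]_(i < n) U i); last first.
    by rewrite -bigcup_seq; apply: eq_bigcupl; split=> // i _; rewrite /= mem_index_enum.
  rewrite /area measure_bigsetU_ord//.
  rewrite (eq_bigr (fun=> s%:E)); last by move=> i _; have [[]] := rU i.
  by rewrite sumEFin sumr_const card_ord mulr_natl.
have : (area (\bigcup_i U i `|` W) <= area (std_disk b))%E.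
  apply: (@le_measure _ _ _ areaM); rewrite ?inE.
  - by apply: measurableU.
  - by apply: measurable_open_plane; exact: open_std_disk.
  - by move=> x [[i _ /UD//]|[]].
rewrite area_setU//; last first.
  apply/seteqP; split=> // x [[i _ Uix] [_]]; apply; exists i => //; exact: subset_closure.
rewrite aU area_std_disk// => le.
have aW := area_open_gt0 oW W0.
rewrite -lte_fin; apply: lt_le_trans le.
by rewrite -{1}[(n%:R * s)%:E]adde0 lteD2lE.
Qed.

Lemma curve_region (b s : R) (L : set (R * R)) : embedded_closed_curve L ->
  L `<=` std_disk b -> bounds_domain_of_area L s ->
  exists U, region b s U L.
Proof.
move=> [gamma [cg _ _ Lg]] LD [U [oU cU bU UL aU]].
have iU : interior U = U by apply/interior_id.
exists U; split=> //; split=> //.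
- rewrite Lg; apply: connected_continuous_connected => //.
  exact: segment_connected.
- by rewrite -UL iU; apply/seteqP; split=> // x [Ux [_]].
- move=> x clx; have [Ux|Ux] := pselect (U x); [by left|right].
  by rewrite -UL iU.
Qed.

Lemma hamiltonian_region (b s : R) (phi : R * R -> R * R) : 0 < s ->
  hamiltonian_diffeomorphism phi -> phi @` std_circle s `<=` std_disk b ->
  region b s (phi @` std_disk s) (phi @` std_circle s).
Proof.
move=> s0 hphi sub.
have [[sphi [g [sg fK gK]]] _] := hphi.
have cphi := class_C_continuous (sphi 0%N).
have cg := class_C_continuous (sg 0%N).
have cpt : compact (phi @` [set z | pi * sqnorm z <= s]).
  apply: continuous_compact; last exact: compact_closed_disk.
  exact: continuous_subspaceT.
have Dsub : phi @` std_disk s `<=` phi @` [set z | pi * sqnorm z <= s].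
  by apply: image_subset => z /ltW.
have bV : bounded_set (phi @` std_disk s).
  have [M [Mr h]] := compact_bounded cpt.
  by exists M; split=> // x Mx z /Dsub; exact: h.
split; split.
- rewrite (image_can2 _ fK gK); apply: open_comp => [z _|]; first exact: cg.
  exact: open_std_disk.
- apply: connected_continuous_connected; first exact: std_disk_connected.
  exact: continuous_subspaceT.
- exact: bV.
- rewrite hamiltonian_area ?area_std_disk ?ltry//.
  + exact: open_std_disk.
  + exact: bounded_std_disk.
- apply: connected_continuous_connected; first exact: std_circle_connected.
  exact: continuous_subspaceT.
- apply/seteqP; split=> // _ [[z Dz <-] [w Cw /(can_inj fK) wz]].
  by move: Dz; rewrite -wz /std_disk /= Cw ltxx.
(* The image of the closed disk is compact, hence closed, so it contains the closure of the image of
   the open disk. *)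
- apply: (@subset_trans _ (phi @` [set z | pi * sqnorm z <= s])).
    rewrite [X in _ `<=` X](closure_id _).1; first exact: closureS.
    exact: compact_closed.
  move=> _ [z + <-]; rewrite /= le_eqVlt => /predU1P[Cz|Dz].
    by right; exists z.
  by left; exists z.
- exact: sub.
Qed.

End Regions.

Theorem theorem1p2 (R : realType) (s b : R) (hs : 0 < s) (hb : 2 * s < b)
    (k : nat) (hk2 : (2 <= k)%N) (hk : k%:R * s < b <= k.+1%:R * s)
    (Lambda : 'I_k -> set (R * R))
    (Lambda_disjoint : forall i j : 'I_k, i != j -> Lambda i `&` Lambda j = set0)
    (Lambda_curve : forall j : 'I_k, embedded_closed_curve (Lambda j))
    (Lambda_sub : forall j : 'I_k, Lambda j `<=` std_disk b)
    (Lambda_area : forall j : 'I_k, bounds_domain_of_area (Lambda j) s)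
    (phi : R * R -> R * R) (hphi : hamiltonian_diffeomorphism phi)
    (phi_sub : phi @` std_circle s `<=` std_disk b) :
  exists j : 'I_k, (phi @` std_circle s) `&` Lambda j !=set0.
Proof.
apply: contrapT => none.
have phiL j : phi @` std_circle s `&` Lambda j = set0.
  apply/eqP; apply: contrapT => /negP/set0P h; apply: none; by exists j.
have /choice[U rU] : forall j, exists U, region b s U (Lambda j).
  by move=> j; exact: curve_region.
(* Index [ord0] stands for the image under [phi], and the lifted indices for the given curves, which
   makes [k.+1] regions. *)
pose V (i : 'I_k.+1) := if unlift ord0 i is Some j then U j else phi @` std_disk s.
pose C (i : 'I_k.+1) := if unlift ord0 i is Some j then Lambda j else phi @` std_circle s.
have rV i : region b s (V i) (C i).
  rewrite /V /C; case: unliftP => [j _|_]; first exact: rU.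
  exact: hamiltonian_region.
have CC i j : i != j -> C i `&` C j = set0.
  rewrite /C; case: unliftP => [i' ->|->]; case: unliftP => [j' ->|->].
  - by rewrite (inj_eq lift_inj); exact: Lambda_disjoint.
  - by rewrite setIC.
  - by [].
  - by rewrite eqxx.
have b0 : 0 < b by lra.
have := regions_area_lt b0 hs rV CC.
by case/andP: hk => _; rewrite leNgt => /negP.
Qed.
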